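(* Let $K$ be a compact Hausdorff space, $X$ be a Banach space, and $T\colon C(K)\to X$ be a bounded operator. Suppose $\mu\colon\Sigma\to X^{**}$ is the representing measure for $T$ and for each $\varepsilon>0$ there exists a decomposition $K=K_E^\varepsilon\cup L^\varepsilon$, where $K_E^\varepsilon$ is an Eberlein compactum and $\|\mu\|(L^\varepsilon)<\varepsilon$. Then the range of $T$ lies in a WCG Banach space.
   Context: A Banach space is weakly compactly generated (WCG) if it contains a weakly compact subset whose linear span is dense. A compact space is an Eberlein compactum if it is homeomorphic to a weakly compact subset of some Banach space. $C(K)$ is the Banach space of continuous scalar-valued (real or complex) functions on $K$ with the supremum norm, and $\Sigma$ is the $\sigma$-algebra of all Borel subsets of $K$. The representing measure of $T$ is the weak*-countably additive vector measure $\mu\colon\Sigma\to X^{**}$ given by $\mu(A)=T^{**}\mathbf{1}_A$; equivalently, $\langle\mu(A),x^*\rangle=\mu_{x^*}(A)$ for $x^*\in X^*$, where $\mu_{x^*}$ is the regular countably additive scalar Borel measure representing the functional $x^*T$ on $C(K)$ by the Riesz theorem. Writing $x^*\circ\mu=\mu_{x^*}$, with total variation $|x^*\circ\mu|$, the semivariation of $\mu$ is $\|\mu\|(A)=\sup\{|x^*\circ\mu|(A)\colon x^*\in X^*,\ \|x^*\|\leqslant 1\}$ for $A\in\Sigma$. *)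

(* Defs.v *)
From HB Require Import structures.
From mathcomp Require Import all_boot all_order all_algebra.
From mathcomp Require Import all_classical all_reals all_analysis.
From mathcomp.real_closed Require Import complex.

Set Implicit Arguments.
Unset Strict Implicit.
Unset Printing Implicit Defensive.

Import Order.TTheory GRing.Theory Num.Theory.
Import numFieldNormedType.Exports.

Local Open Scope classical_set_scope.
Local Open Scope ring_scope.

Variant scalar_kind := RealScalars | ComplexScalars.

Definition scalar_field (R : realType) (k : scalar_kind) : numFieldType :=
  match k with RealScalars => R | ComplexScalars => R[i] end.

Section scalars.
Context {R : realType} {k : scalar_kind}.
Local Notation F := (scalar_field R k).

Definition scalar_re : F -> R :=
  match k return scalar_field R k -> R with
  | RealScalars => fun x => x
  | ComplexScalars => fun z => complex.Re z
  end.

Definition scalar_im : F -> R :=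
  match k return scalar_field R k -> R with
  | RealScalars => fun=> 0
  | ComplexScalars => fun z => complex.Im z
  end.

(* a + ib; the imaginary part is dropped for real scalars. *)
Definition mk_scalar : R -> R -> F :=
  match k return R -> R -> scalar_field R k with
  | RealScalars => fun a _ => a
  | ComplexScalars => fun a b => Complex a b
  end.

(* The library's norms take values in the scalar field; this is their real
   value. *)
Definition rnorm {V : normedModType F} (x : V) : R := scalar_re `|x|.

Definition rabs (x : F) : R := scalar_re `|x|.

Lemma scalar_reD (x y : F) : scalar_re (x + y) = scalar_re x + scalar_re y.
Proof.
by rewrite /scalar_re; move: x y; case: k => //= x y; rewrite raddfD.
Qed.

Lemma scalar_re_le (x y : F) : x <= y -> scalar_re x <= scalar_re y.
Proof.
rewrite /scalar_re; move: x y; case: k => //= -[a b] [c d].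
by rewrite lecE => /andP[].
Qed.

Lemma scalar_reK (x : F) : 0 <= x -> mk_scalar (scalar_re x) 0 = x.
Proof.
rewrite /scalar_re /mk_scalar; move: x; case: k => //= -[a b].
by rewrite lecE /= => /andP[/eqP->].
Qed.

Lemma mk_scalarK (a : R) : scalar_re (mk_scalar a 0) = a.
Proof. by rewrite /scalar_re /mk_scalar; case: k. Qed.

Lemma mk_scalarD (a b : R) :
  mk_scalar (a + b) 0 = mk_scalar a 0 + mk_scalar b 0.
Proof.
rewrite /mk_scalar; case: k => //=; apply/eqP.
by rewrite eq_complex/= addr0 !eqxx.
Qed.

Lemma mk_scalarM (a b : R) :
  mk_scalar (a * b) 0 = mk_scalar a 0 * mk_scalar b 0.
Proof.
rewrite /mk_scalar; case: k => //=; apply/eqP.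
by rewrite eq_complex/= !(mulr0, mul0r, subr0, addr0) !eqxx.
Qed.

Lemma mk_scalar_le (a b : R) : a <= b -> mk_scalar a 0 <= mk_scalar b 0 :> F.
Proof. by rewrite /mk_scalar; case: k => //= ab; rewrite lecE /= eqxx. Qed.

Lemma mk_scalar0 : mk_scalar 0 0 = 0 :> F.
Proof. by rewrite /mk_scalar; case: k. Qed.

Lemma rabs0 : rabs 0 = 0.
Proof. by rewrite /rabs normr0 -mk_scalar0 mk_scalarK. Qed.

Lemma rabs_ge0 (x : F) : 0 <= rabs x.
Proof. by rewrite -rabs0; apply: scalar_re_le; rewrite normr0. Qed.

Lemma rabsE (x : F) : mk_scalar (rabs x) 0 = `|x|.
Proof. exact: scalar_reK. Qed.

Lemma rabsD (x y : F) : rabs (x + y) <= rabs x + rabs y.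
Proof. by rewrite /rabs -scalar_reD; apply: scalar_re_le; exact: ler_normD. Qed.

Lemma mk_scalar_inj (a b : R) : mk_scalar a 0 = mk_scalar b 0 :> F -> a = b.
Proof. by move=> /(congr1 scalar_re); rewrite !mk_scalarK. Qed.

Lemma rabsM (x y : F) : rabs (x * y) = rabs x * rabs y.
Proof. by apply: mk_scalar_inj; rewrite mk_scalarM !rabsE normrM. Qed.

Lemma rabs_eq0 (x : F) : rabs x = 0 -> x = 0.
Proof. by move=> x0; apply: normr0_eq0; rewrite -rabsE x0 mk_scalar0. Qed.

End scalars.

Section continuous_functions.
Context {R : realType} {k : scalar_kind} {K : topologicalType}.
Local Notation F := (scalar_field R k).

Definition is_cfun : {pred K -> F^o} := fun f => `[< continuous f >].

Lemma is_cfun_submod_closed : submod_closed is_cfun.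
Proof.
split; first by apply/asboolP => x; exact: cvg_cst.
move=> a f g /asboolP cf /asboolP cg; apply/asboolP => x.
by apply: cvgD; [apply: cvgZr; exact: cf | exact: cg].
Qed.

HB.instance Definition _ :=
  GRing.isSubmodClosed.Build _ _ is_cfun is_cfun_submod_closed.

Record cfun := Cfun { cfun_val :> K -> F^o; cfunP : cfun_val \in is_cfun }.

HB.instance Definition _ := [isSub for cfun_val].
HB.instance Definition _ := [Choice of cfun by <:].
HB.instance Definition _ := [SubChoice_isSubLmodule of cfun by <:].

(* For compact K the supremum is that of a bounded set. *)
Definition sup_norm (f : cfun) : R := sup [set rabs (f t) | t in [set: K]].

End continuous_functions.
Arguments cfun R k K : clear implicits.

Section dual.
Context {R : realType} {k : scalar_kind} {X : normedModType (scalar_field R k)}.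
Local Notation F := (scalar_field R k).

Definition is_functional : {pred X -> F^o} :=
  fun phi => `[< linear phi /\ continuous phi >].

Lemma is_functional_submod_closed : submod_closed is_functional.
Proof.
split.
  apply/asboolP; split; last by move=> x; exact: cvg_cst.
  by move=> a x y /=; rewrite scaler0 addr0.
move=> a f g /asboolP[lf cf] /asboolP[lg cg]; apply/asboolP; split.
  move=> b x y; rewrite !fctE lf lg !scalerDr !scalerA (mulrC a b).
  by rewrite addrACA.
move=> x; by apply: cvgD; [apply: cvgZr; exact: cf | exact: cg].
Qed.

HB.instance Definition _ := GRing.isSubmodClosed.Build _ _ is_functional
  is_functional_submod_closed.

Record dual := Dual { dual_val :> X -> F^o; dualP : dual_val \in is_functional }.

HB.instance Definition _ := [isSub for dual_val].
HB.instance Definition _ := [Choice of dual by <:].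
HB.instance Definition _ := [SubChoice_isSubLmodule of dual by <:].

Definition op_norm (phi : dual) : R :=
  sup [set rabs (phi x) | x in [set x : X | `|x| <= 1]].

Lemma functional_linear (phi : dual) : linear phi.
Proof. by have /asboolP[] := dualP phi. Qed.

Lemma functional_continuous (phi : dual) : continuous phi.
Proof. by have /asboolP[] := dualP phi. Qed.

HB.instance Definition _ (phi : dual) :=
  GRing.isLinear.Build F X F^o *:%R phi (functional_linear phi).

Let op_set (phi : dual) : set R :=
  [set rabs (phi x) | x in [set x : X | `|x| <= 1]].

Let op_set_has_sup (phi : dual) : has_sup (op_set phi).
Proof.
split; first by exists (rabs (phi 0)); exists 0; rewrite //= normr0 ler01.
have /(@linear_bounded_continuous _ _ _ phi)/linear_boundedP :=
  @functional_continuous phi.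
move=> /pinfty_ex_gt0[M M0 HM].
exists (scalar_re M) => _ [x /= x1 <-]; apply: scalar_re_le.
by rewrite (le_trans (HM x))// ler_piMr// ltW.
Qed.

Let le_op_norm (phi : dual) (x : X) : `|x| <= 1 -> rabs (phi x) <= op_norm phi.
Proof. by move=> x1; apply: ub_le_sup; [case: (op_set_has_sup phi)|exists x]. Qed.

Let op_norm_le (phi : dual) (M : R) :
  (forall x : X, `|x| <= 1 -> rabs (phi x) <= M) -> op_norm phi <= M.
Proof.
move=> HM; apply: ge_sup; first by case: (op_set_has_sup phi).
by move=> _ [x /= x1 <-]; exact: HM.
Qed.

Let op_norm_ge0 (phi : dual) : 0 <= op_norm phi.
Proof.
have /(le_op_norm phi) : `|0 : X| <= 1 by rewrite normr0 ler01.
exact/le_trans/rabs_ge0.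
Qed.

Let dual_norm (phi : dual) : F := mk_scalar (op_norm phi) 0.

Let dual_normD (phi psi : dual) :
  dual_norm (phi + psi) <= dual_norm phi + dual_norm psi.
Proof.
rewrite -mk_scalarD; apply: mk_scalar_le; apply: op_norm_le => x x1.
by apply: (le_trans (rabsD _ _)); apply: lerD; exact: le_op_norm.
Qed.

Let dual_normZ (a : F) (phi : dual) :
  dual_norm (a *: phi) = `|a| * dual_norm phi.
Proof.
rewrite -rabsE -mk_scalarM; congr mk_scalar; apply/eqP; rewrite eq_le.
apply/andP; split.
  apply: op_norm_le => x x1; rewrite rabsM.
  by apply: ler_wpM2l; [exact: rabs_ge0|exact: le_op_norm].
have [a0|a0] := eqVneq (rabs a) 0.
  by rewrite a0 mul0r; exact: op_norm_ge0.
have {}a0 : 0 < rabs a by rewrite lt0r a0 rabs_ge0.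
rewrite mulrC -ler_pdivlMr//; apply: op_norm_le => x x1.
by rewrite ler_pdivlMr// mulrC -rabsM; exact: (le_op_norm (a *: phi)).
Qed.

Let dual_norm0_eq0 (phi : dual) : dual_norm phi = 0 -> phi = 0.
Proof.
rewrite -mk_scalar0 => /mk_scalar_inj phi0.
have phi1 (x : X) : `|x| <= 1 -> phi x = 0.
  move=> /(le_op_norm phi); rewrite phi0 => x0; apply: rabs_eq0; apply/eqP.
  by rewrite eq_le x0 rabs_ge0.
apply: val_inj; apply/funext => x /=.
have [->|x0] := eqVneq x 0; first by rewrite raddf0.
rewrite -[x](scalerKV (_ : `|x| != 0)) ?normr_eq0// linearZ/= phi1 ?scaler0//.
by rewrite normfZV.
Qed.

HB.instance Definition _ := Lmodule_isNormed.Build F dual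
  dual_normD dual_normZ dual_norm0_eq0.

Lemma dual_normE (phi : dual) : `|phi| = mk_scalar (op_norm phi) 0.
Proof. by []. Qed.

End dual.
Arguments dual {R k} X.

Notation bidual X := (dual (dual X)).

Section weak_topology.
Context {R : realType} {k : scalar_kind}.
Local Notation F := (scalar_field R k).

(* The explicit arguments keep the topology inference from unfolding
   initial_topology to X and picking the norm topology. *)
Definition weak (X : normedModType F) : topologicalType :=
  @initial_topology X {ptws dual X -> F^o} (fun x phi => phi x).

Definition linear_span (X : lmodType F) (W : set X) : set X :=
  [set x | exists n (a : 'I_n -> F) (w : 'I_n -> X),
     (forall i, W (w i)) /\ x = \sum_(i < n) a i *: w i].

Definition WCG (X : completeNormedModType F) : Prop :=
  exists W : set X, compact (W : set (weak X)) /\ dense (linear_span W).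

Definition homeomorphic (S T : topologicalType) : Prop :=
  exists (f : S -> T) (g : T -> S),
    [/\ cancel f g, cancel g f, continuous f & continuous g].

Lemma weak_functional_continuous (X : normedModType F) (phi : dual X) :
  continuous (phi : weak X -> F^o).
Proof.
move=> x; apply: (@continuous_comp (weak X) {ptws dual X -> F^o} F^o
  (fun x phi => phi x) (fun g => g phi)).
  exact: initial_continuous.
exact: (@proj_continuous _ (fun=> F^o) phi).
Qed.

End weak_topology.

Definition eberlein_compactum (R : realType) (k : scalar_kind)
    (S : topologicalType) : Prop :=
  exists (E : completeNormedModType (scalar_field R k)) (W : set (weak E)),
    compact W /\ homeomorphic S (set_type W).

Definition borel (K : ptopologicalType) := g_sigma_algebraType (@open K).

Section scalar_measures.
Context {R : realType} {k : scalar_kind} {K : ptopologicalType}.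
Local Notation F := (scalar_field R k).

Definition total_variation (nu : set (borel K) -> F) (A : set (borel K)) :
    \bar R :=
  ereal_sup [set s | exists n (P : 'I_n -> set (borel K)),
    [/\ forall i, measurable (P i), trivIset setT P, \bigcup_i P i = A &
        s = (\sum_(i < n) rabs (nu (P i)))%:E]].

Definition regular (nu : set (borel K) -> F) : Prop :=
  forall A : set (borel K), measurable A -> forall e : R, 0 < e ->
    exists C U : set K, [/\ closed C, open U, C `<=` A, A `<=` U &
      (total_variation nu (U `\` C) < e%:E)%E].

End scalar_measures.

Section real_and_imaginary_parts.
Context {R : realType} {k : scalar_kind}.
Local Notation F := (scalar_field R k).

Let additive_contraction_continuous (h : F -> R) :
  {morph h : x y / x - y} -> (forall x, `|h x| <= rabs x) -> continuous h.
Proof.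
move=> hB hle x; apply/(@cvgrPdist_lt _ _ _ (nbhs x)) => e e0.
have e0' : 0 < mk_scalar e 0 :> F.
  rewrite lt0r -[X in _ <= X]/(mk_scalar e 0) -{2}mk_scalar0.
  rewrite mk_scalar_le ?ltW// andbT; apply: contraTN e0 => /eqP.
  by rewrite -mk_scalar0 => /mk_scalar_inj ->; rewrite ltxx.
apply: (@filterS _ (nbhs x)); last exact: (@nbhsx_ballx F F x _ e0').
move=> y; rewrite -ball_normE/= => xye.
rewrite -hB (le_lt_trans (hle _))// ltNge; apply/negP.
by move=> /(@mk_scalar_le _ k); rewrite rabsE => /(lt_le_trans xye); rewrite ltxx.
Qed.

Lemma scalar_reB : {morph @scalar_re R k : x y / x - y}.
Proof. by rewrite /scalar_re; case: k => //= x y; rewrite raddfB. Qed.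

Lemma scalar_imB : {morph @scalar_im R k : x y / x - y}.
Proof. by rewrite /scalar_im; case: k => //= x y; rewrite ?subr0// raddfB. Qed.

Lemma scalar_re_continuous : continuous (@scalar_re R k).
Proof.
apply: additive_contraction_continuous scalar_reB _.
rewrite /rabs /scalar_re; case: k => //= z.
by have := normc_ge_Re z; rewrite lecE => /andP[].
Qed.

Lemma scalar_im_continuous : continuous (@scalar_im R k).
Proof.
apply: additive_contraction_continuous scalar_imB _.
rewrite /rabs /scalar_im /scalar_re; case: k => /= [x|z].
  by rewrite normr0.
case: z => a b /=.
by rewrite -sqrtr_sqr ler_sqrt ?addr_ge0 ?sqr_ge0// lerDr sqr_ge0.
Qed.

Context d {T : measurableType d}.
Implicit Type nu : {charge set T -> \bar F}.

Let part (h : F -> R) nu (A : set T) : \bar R := (h (fine (nu A)))%:E.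

Let part_sigma_additive (h : F -> R) nu :
  {morph h : x y / x - y} -> continuous h -> semi_sigma_additive (part h nu).
Proof.
move=> hB hc P mP tP mU /=.
have h0 : h 0 = 0 by rewrite -[X in h X](subrr 0) hB subrr.
have hN x : h (- x) = - h x by rewrite -sub0r hB h0 sub0r.
have hD x y : h (x + y) = h x + h y by rewrite -[y]opprK hB (hN (- y)).
have Pfin A : measurable A -> nu A = (fine (nu A))%:E.
  by move=> mA; rewrite fineK// fin_num_measure.
have -> : (fun n => \sum_(0 <= i < n) part h nu (P i))%E =
    EFin \o h \o (fun n => \sum_(0 <= i < n) fine (nu (P i))).
  apply/funext => n /=; rewrite sumEFin; congr EFin.
  by apply: (big_ind2 (fun x y => x = h y)) => // _ x _ y -> ->.
apply: cvg_EFin; first by near=> n.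
apply: (cvg_comp _ h) (hc _) => V VnuU.
have := @charge_semi_sigma_additive _ _ _ nu P mP tP mU.
rewrite (Pfin _ mU) => /(_ (fun y => V (fine y)))/(_ VnuU).
apply: (@filterS _ \oo) => n; rewrite /=; congr V.
rewrite (eq_bigr (fun i => (fine (nu (P i)))%:E)) => [|i _]; last exact: Pfin.
by rewrite sumEFin.
Unshelve. all: by end_near. Qed.

Definition re_charge nu (A : set T) : \bar R := (scalar_re (fine (nu A)))%:E.
Definition im_charge nu (A : set T) : \bar R := (scalar_im (fine (nu A)))%:E.

Let re_charge0 nu : re_charge nu set0 = 0%E.
Proof. by rewrite /re_charge charge0 -[0%E]/0%:E/= -mk_scalar0 mk_scalarK. Qed.

Let im_charge0 nu : im_charge nu set0 = 0%E.
Proof. by rewrite /im_charge charge0/= -(subrr 0) scalar_imB subrr. Qed.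

HB.instance Definition _ nu := isCharge.Build _ T R (re_charge nu)
  (re_charge0 nu) (fun A _ => erefl)
  (part_sigma_additive scalar_reB scalar_re_continuous).

HB.instance Definition _ nu := isCharge.Build _ T R (im_charge nu)
  (im_charge0 nu) (fun A _ => erefl)
  (part_sigma_additive scalar_imB scalar_im_continuous).

End real_and_imaginary_parts.

Section integration.
Context {R : realType} d {T : measurableType d}.

Lemma hahn_exists (nu : {charge set T -> \bar R}) :
  exists PN : set T * set T, hahn_decomposition nu PN.1 PN.2.
Proof. by have [P [N PN]] := Hahn_decomposition nu; exists (P, N). Qed.

Definition jordan_integral (nu : {charge set T -> \bar R}) (f : T -> R) : R :=
  let nuPN := projT2 (cid (hahn_exists nu)) in
  \int[jordan_pos nuPN]_x f x - \int[jordan_neg nuPN]_x f x.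

(* (u + iv) d(nu1 + i nu2) = (u dnu1 - v dnu2) + i (u dnu2 + v dnu1) *)
Definition scalar_integral (k : scalar_kind)
    (nu : {charge set T -> \bar (scalar_field R k)}) (f : T -> scalar_field R k) :
    scalar_field R k :=
  mk_scalar
    (jordan_integral (re_charge nu) (scalar_re \o f)
      - jordan_integral (im_charge nu) (scalar_im \o f))
    (jordan_integral (im_charge nu) (scalar_re \o f)
      + jordan_integral (re_charge nu) (scalar_im \o f)).

End integration.

Section operators.
Context {R : realType} {k : scalar_kind} {K : ptopologicalType}.
Local Notation F := (scalar_field R k).

Definition bounded_operator (X : normedModType F) (T : cfun R k K -> X) : Prop :=
  exists M : R, forall f, rnorm (T f) <= M * sup_norm f.

Definition riesz_measure (phi : cfun R k K -> F)
    (nu : {charge set (borel K) -> \bar F}) : Prop :=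
  regular (fine \o nu) /\ forall f, phi f = scalar_integral nu f.

(* <T**(1_A), xs> = <1_A, T* xs> is the value at A of the Riesz measure of
   T* xs = xs \o T. Only the values of mu on Borel sets are constrained. *)
Definition representing_measure (X : normedModType F) (T : cfun R k K -> X)
    (mu : set (borel K) -> bidual X) : Prop :=
  forall xs : dual X, exists nu : {charge set (borel K) -> \bar F},
    riesz_measure (xs \o T) nu /\
    forall A, measurable A -> mu A xs = fine (nu A).

Definition semivariation (X : normedModType F)
    (mu : set (borel K) -> bidual X) (A : set (borel K)) : \bar R :=
  ereal_sup [set total_variation (fun B => mu B xs) A
            | xs in [set xs : dual X | `|xs| <= 1]].

End operators.

(* The set A, with the linear structure and norm of X, sits isometrically inside
   a weakly compactly generated Banach space, which need not be a subspace
   of X. *)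
Definition lies_in_WCG (R : realType) (k : scalar_kind)
    (X : normedModType (scalar_field R k)) (A : set X) : Prop :=
  exists (Y : completeNormedModType (scalar_field R k)) (j : X -> Y),
    [/\ WCG Y,
        forall a x y, A x -> A y -> j (a *: x + y) = a *: j x + j y &
        forall x, A x -> `|j x| = `|x|].

(* Main.v *)
(* Let [K_n] be the Eberlein part of K for [eps = 1/n].  Functions vanishing on [K_n]
   and bounded by 1 have image of norm at most [8/n] under T, so that, for every x*
   in the unit ball of X*, Hahn-Banach splits [x* o T] as the sum of a functional of
   norm at most [8/n] and of a functional that only depends on the restriction to
   [K_n].  Letting x* vary, T, seen as an operator into the bounded functions on X*,
   is a norm limit of operators [T_n] that factor through [C(K_n)].  Hence its range
   lies in the closed span of the ranges of the [T_n], and it is enough to find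
   countably many weakly compact sets that generate [C(K_n)].

   Embed [K_n] as a weakly compact subset of a Banach space E.  The restrictions to
   [K_n] of the real parts of the functionals in the unit ball of E* form a pointwise
   compact set (Alaoglu) that separates points.  Iterating the lattice operations and
   bounded affine maps on it produces pointwise compact bounded sets of continuous
   functions whose union is dense (Stone-Weierstrass, lattice form).  Pointwise
   compact bounded sets are weakly compact (Grothendieck): this reduces to bounded
   convergence for functionals on [C(K_n)], for which Dini's theorem suffices, so that
   neither the Riesz representation theorem nor Eberlein-Smulian is needed. *)
Require Import Defs.
From HB Require Import structures.
From mathcomp Require Import all_boot all_order all_algebra.
From mathcomp Require Import all_classical all_reals all_analysis.
From mathcomp Require Import measurable_realfun ring lra.
From mathcomp.real_closed Require Import complex.

Import Order.TTheory GRing.Theory Num.Theory.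
Import numFieldNormedType.Exports.

Set Implicit Arguments.
Unset Strict Implicit.
Unset Printing Implicit Defensive.

Local Open Scope classical_set_scope.
Local Open Scope ring_scope.

(** * Bounded convergence for functionals on C(S) *)

(** If [Q A] failed, the sets whose complement in [A] satisfies [Q] would form a proper filter
    containing [A], and a cluster point of it would contradict the local hypothesis. This stands in
    for the extraction of finite subcovers. *)
Lemma compact_ind (S : topologicalType) (A : set S) (Q : set S -> Prop) :
  compact A -> Q set0 -> (forall U V, U `<=` V -> Q V -> Q U) ->
  (forall U V, Q U -> Q V -> Q (U `|` V)) ->
  (forall x, A x -> exists2 U, nbhs x U & Q U) -> Q A.
Proof.
move=> cA Q0 Qmono QU Qloc; apply: contrapT => nQA.
pose G : set_system S := [set B | Q (A `\` B)].
have FG : ProperFilter G.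
  apply: Build_ProperFilter.
    by move=> G0; apply: nQA; apply: Qmono G0; rewrite setD0.
  split.
  - by rewrite /G /= setDT.
  - by move=> U V GU GV; rewrite /G /= setDIr; exact: QU.
  - by move=> U V UV; apply: Qmono => x [Ax nVx]; split=> // /UV.
have GA : G A by rewrite /G /= setDv.
have [x [Ax clx]] := cA _ FG GA.
have [U Ux QUx] := Qloc x Ax.
have GU : G (~` U) by apply: Qmono QUx => y [_]; rewrite /= notK.
by have [y []] := clx _ _ GU Ux.
Qed.

Lemma nbhs_real_lt (R : realType) (S : topologicalType) (f : S -> R) (s : S)
    (e : R) : {for s, continuous f} -> 0 < e ->
  nbhs s [set t | `|f t - f s| < e].
Proof.
move=> /(@cvgrPdist_lt _ R^o) cf e0; have := cf e e0.
by apply: (@filterS _ (nbhs s)) => t /=; rewrite distrC.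
Qed.

(** Each point has a neighbourhood on which some [h n] is below [e]; by monotonicity the larger of
    two indices serves for a union. *)
Lemma dini (R : realType) (S : topologicalType) (h : nat -> S -> R) (e : R) :
  compact [set: S] -> (forall n, continuous (h n)) ->
  (forall m n s, (m <= n)%N -> h n s <= h m s) -> 0 < e ->
  (forall s, exists n, h n s < e) -> exists n, forall s, h n s < e.
Proof.
move=> cS ch hmono e0 hs.
suff [n nP] : exists n, forall s, setT s -> h n s < e by exists n => s; exact: nP.
apply: (@compact_ind S setT (fun U => exists n, forall s, U s -> h n s < e) cS).
- by exists 0%N.
- by move=> U V UV [n nP]; exists n => s /UV; exact: nP.
- move=> U V [n nP] [m mP]; exists (maxn n m) => s [/nP|/mP].
    by apply: le_lt_trans; apply: hmono; rewrite leq_maxl.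
  by apply: le_lt_trans; apply: hmono; rewrite leq_maxr.
- move=> s _; have [n hn] := hs s.
  exists [set t | `|h n t - h n s| < e - h n s].
    by apply: nbhs_real_lt; [exact: ch | rewrite subr_gt0].
  by exists n => t /= /ltr_normlP[]; lra.
Qed.

Section continuous_real.
Context {R : realType} {S : topologicalType}.
Implicit Types f g : S -> R.

Lemma continuous_fmax f g : continuous f -> continuous g ->
  continuous (fun s => Num.max (f s) (g s)).
Proof. by move=> cf cg s; exact: (@continuous_max R S f g s (cf s) (cg s)). Qed.

Lemma continuous_fmin f g : continuous f -> continuous g ->
  continuous (fun s => Num.min (f s) (g s)).
Proof. by move=> cf cg s; exact: (@continuous_min R S f g s (cf s) (cg s)). Qed.

Lemma continuous_fadd f g : continuous f -> continuous g ->
  continuous (fun s => f s + g s).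
Proof. by move=> cf cg s; apply: (@cvgD R R^o _ _ _ f g) (cf s) (cg s). Qed.

Lemma continuous_fsub f g : continuous f -> continuous g ->
  continuous (fun s => f s - g s).
Proof. by move=> cf cg s; apply: (@cvgB R R^o _ _ _ f g) (cf s) (cg s). Qed.

Lemma continuous_fmul f g : continuous f -> continuous g ->
  continuous (fun s => f s * g s).
Proof. by move=> cf cg s; exact: (@continuousM R S f g s (cf s) (cg s)). Qed.

Lemma continuous_fopp f : continuous f -> continuous (fun s => - f s).
Proof. by move=> cf s; apply: (@cvgN R R^o _ _ _ f) (cf s). Qed.

Lemma continuous_fnorm f : continuous f -> continuous (fun s => `|f s|).
Proof. by move=> cf s; apply: (@cvg_norm R R^o _ _ _ f) (cf s). Qed.

End continuous_real.

Section bounded_convergence.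
Context {R : realType} {S : topologicalType}.
Hypothesis cS : compact [set: S].
Variables (lam : (S -> R) -> R) (C : R).
Hypothesis lamD : forall f g : S -> R, continuous f -> continuous g ->
  lam (fun s => f s + g s) = lam f + lam g.
Hypothesis lam_le : forall (f : S -> R) (M : R), continuous f -> 0 <= M ->
  (forall s, `|f s| <= M) -> `|lam f| <= C * M.

Implicit Types (g h a b : S -> R) (M : R).

Let dom (g : S -> R) : set (S -> R) :=
  [set h | continuous h /\ forall s, `|h s| <= g s].

(** For [g >= 0] this is the value at [g] of the modulus [|lam|]: it plays the role of the integral
    of [g] against the total variation of [lam], without any measure. *)
Definition gauge (g : S -> R) : R := sup (lam @` dom g).

Let dom0 g : (forall s, 0 <= g s) -> dom g (fun=> 0).
Proof. by move=> g0; split=> [|s]; [exact: cst_continuous | rewrite normr0]. Qed.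

Let has_sup_gauge g M : (forall s, 0 <= g s) -> 0 <= M -> (forall s, g s <= M) ->
  has_sup (lam @` dom g).
Proof.
move=> g0 M0 gM; split; first by exists (lam (fun=> 0)), (fun=> 0); first exact: dom0.
exists (C * M) => _ [h [ch hg] <-]; rewrite (le_trans (ler_norm _))//.
by apply: lam_le => // s; rewrite (le_trans (hg s)).
Qed.

Lemma gauge_le g M : (forall s, 0 <= g s) -> 0 <= M -> (forall s, g s <= M) ->
  gauge g <= C * M.
Proof.
move=> g0 M0 gM; apply: ge_sup; first by case: (has_sup_gauge g0 M0 gM).
move=> _ [h [ch hg] <-]; rewrite (le_trans (ler_norm _))//.
by apply: lam_le => // s; rewrite (le_trans (hg s)).
Qed.

Lemma le_gauge h g M : continuous h -> (forall s, `|h s| <= g s) -> 0 <= M ->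
  (forall s, g s <= M) -> lam h <= gauge g.
Proof.
move=> ch hg M0 gM; have g0 s : 0 <= g s by rewrite (le_trans _ (hg s)).
by apply: ub_le_sup; [case: (has_sup_gauge g0 M0 gM) | exists h].
Qed.

(* If |h| <= a + b, clamping h at the level max a b leaves a remainder of modulus
   at most min a b. *)
Lemma gauge_supermodular a b M : continuous a -> continuous b ->
  (forall s, 0 <= a s) -> (forall s, 0 <= b s) -> 0 <= M ->
  (forall s, a s <= M) -> (forall s, b s <= M) ->
  gauge a + gauge b <=
    gauge (fun s => Num.max (a s) (b s)) + gauge (fun s => Num.min (a s) (b s)).
Proof.
move=> ca cb a0 b0 M0 aM bM.
set u := fun s => Num.max _ _; set v := fun s => Num.min _ _.
have cu : continuous u by exact: continuous_fmax.
rewrite -lerBrDr; apply: ge_sup; first by case: (has_sup_gauge a0 M0 aM).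
move=> _ [h1 [ch1 h1a] <-]; rewrite lerBrDr addrC -lerBrDr.
apply: ge_sup; first by case: (has_sup_gauge b0 M0 bM).
move=> _ [h2 [ch2 h2b] <-]; rewrite lerBrDr addrC.
pose k1 s := Num.max (- u s) (Num.min (u s) (h1 s + h2 s)).
pose k2 s := h1 s + h2 s - k1 s.
have ch : continuous (fun s => h1 s + h2 s).
  exact: continuous_fadd.
have ck1 : continuous k1.
  by apply: continuous_fmax; [exact: continuous_fopp|exact: continuous_fmin].
have ck2 : continuous k2.
  exact: continuous_fsub.
rewrite -lamD//.
have -> : (fun s => h1 s + h2 s) = (fun s => k1 s + k2 s).
  by apply/funext => s; rewrite /k2 [RHS]addrC subrK.
have uM s : u s <= M by rewrite ge_max aM bM.
have vM s : v s <= M by rewrite ge_min aM.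
rewrite lamD//; apply: lerD; apply: (@le_gauge _ _ M) => // s.
  rewrite /k1 /u; move: (a0 s) (b0 s) (h1a s) (h2b s).
  rewrite !ler_norml /Num.max /Num.min.
  by do ![case: ifPn] => *; lra.
rewrite /k2 /k1 /u /v; move: (a0 s) (b0 s) (h1a s) (h2b s).
rewrite !ler_norml /Num.max /Num.min.
by do ![case: ifPn] => *; lra.
Qed.

(** Were all gauges at least [e], the running minima [H] of near-maximizers [G] would, by
    supermodularity, keep a gauge above [e / 2], although they decrease to 0 pointwise and hence, by
    Dini, uniformly. *)
Lemma gauge_limit (g : nat -> S -> R) M (e : R) :
  (forall n, continuous (g n)) -> (forall n s, 0 <= g n s <= M) -> 0 <= M ->
  (forall s (d : R), 0 < d -> exists N, forall n, (N <= n)%N -> g n s < d) ->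
  0 < e -> exists n, gauge (g n) < e.
Proof.
move=> cg g0M M0 glim e0; apply: contrapT => /forallNP ge.
have {}ge n : e <= gauge (g n) by rewrite leNgt; apply/negP/ge.
(* [dom' n] stands for the finite maxima of the [g j] with [n <= j]: it is closed
   under maxima, and its members tend pointwise to 0. *)
pose dom' n : set (S -> R) :=
  [set G : S -> R | continuous G /\ forall s, 0 <= G s /\ exists2 j, (n <= j)%N & G s <= g j s].
have domM n G : dom' n G -> forall s, G s <= M.
  by move=> [_ Gs] s; have [_ [j _ /le_trans->//]] := Gs s; case/andP: (g0M j s).
have dom'g n : dom' n (g n).
  by split=> // s; split; [case/andP: (g0M n s) | exists n].
pose U n := sup (gauge @` dom' n).
have supU n : has_sup (gauge @` dom' n).
  split; first by exists (gauge (g n)), (g n).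
  exists (C * M) => _ [G nG <-]; apply: gauge_le => //; last exact: domM nG.
  by move=> s; have [_ /(_ s)[]] := nG.
have leU n G : dom' n G -> gauge G <= U n.
  by move=> nG; apply: ub_le_sup; [case: (supU n) | exists G].
(* The errors [d n] sum to [e / 2], and [d n] equals the sum of all later ones; hence the form of
   the invariant [gaugeH]. *)
pose d n : R := e / 2 ^+ n.+2.
have d0 n : 0 < d n by rewrite divr_gt0// exprn_gt0.
have dS n : d n = d n.+1 + d n.+1.
  rewrite /d (exprS _ n.+2); have : 2 ^+ n.+2 != 0 :> R by rewrite expf_neq0.
  by move: (2 ^+ n.+2) => q q0; field.
have /choice[G GP] n : exists G, dom' n G /\ U n - d n < gauge G.
  by have [_ [G nG <-] UG] := sup_adherent (d0 n) (supU n); exists G.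
pose H := fix H n := if n is n'.+1
  then (fun s => Num.min (H n' s) (G n s)) else G 0%N.
have HG n s : H n s <= G n s by case: n => //= n; rewrite ge_min lexx orbT.
have domH n : dom' n (H n).
  elim: n => [|n [cH IH]] /=; first by case: (GP 0%N).
  have [[cG Gs] _] := GP n.+1; split; first exact: continuous_fmin.
  move=> s; split; first by rewrite le_min; case: (IH s) => ->; case: (Gs s) => ->.
  by have [_ [j nj Gj]] := Gs s; exists j => //; rewrite (le_trans (HG n.+1 s)).
have gaugeH n : U n - e / 2 + d n <= gauge (H n).
  elim: n => [|n IH].
    have d00 : d 0%N = e / 4 by rewrite /d expr2; field.
    by have [_] := GP 0%N; rewrite d00 /=; lra.
  have [nG UG] := GP n.+1; have nH := domH n.
  have := @gauge_supermodular (H n) (G n.+1) M nH.1 nG.1 (fun s => (nH.2 s).1)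
    (fun s => (nG.2 s).1) M0 (domM _ _ nH) (domM _ _ nG).
  set mx := gauge (fun s => Num.max _ _); set mn := gauge _.
  (* The maximum of [H n] and [G n.+1] belongs to [dom' n], so that [U n] cancels in the
     supermodular inequality. *)
  have : mx <= U n.
    apply: leU; split; first by apply: continuous_fmax; [case: nH|case: nG].
    move=> s; rewrite le_max (nH.2 s).1; split=> //.
    rewrite /Num.max; case: ifPn => _; last by case: (nH.2 s).
    by have [_ [j nj Gj]] := nG.2 s; exists j => //; rewrite ltnW.
  by move: IH UG (dS n) => /=; rewrite -/mn; lra.
(* Small enough for [C * eta <= e / 4], against [gauge (H n) > e / 2]. *)
pose eta := e / (4 * (`|C| + 1)).
have C1 : 0 < `|C| + 1 by rewrite ltr_wpDl.
have eta0 : 0 < eta by rewrite divr_gt0// mulr_gt0.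
have [] := @dini R S H eta cS _ _ eta0.
- by move=> n; case: (domH n).
- move=> m n s /subnK <-; elim: (n - m)%N => //= i /(le_trans _)->//.
  by rewrite ge_min lexx.
- move=> s; have [N NP] := glim s eta eta0; exists N.
  by have [_ [j /NP gj /le_lt_trans->]] := (domH N).2 s.
move=> n Hn; have := gaugeH n.
have : gauge (H n) <= C * eta.
  by apply: gauge_le => [s||s]; [case: ((domH n).2 s) | exact: ltW | exact: ltW].
have := leU n _ (dom'g n); have := ge n; have := d0 n.
have : C * eta <= e / 4.
  have <- : (`|C| + 1) * eta = e / 4 by rewrite /eta; field; rewrite gt_eqF.
  by rewrite ler_wpM2r// ?ltW// (le_lt_trans (ler_norm C))// ltrDl.
by lra.
Qed.

(** Both [lam (f n) - lam f0] and its opposite are at most the gauge of [|f n - f0|], to which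
    [gauge_limit] applies. *)
Lemma bounded_convergence (f : nat -> S -> R) (f0 : S -> R) M (e : R) :
  (forall n, continuous (f n)) -> continuous f0 ->
  (forall n s, `|f n s| <= M) -> (forall s, `|f0 s| <= M) -> 0 <= M ->
  (forall s (d : R), 0 < d -> exists N, forall n, (N <= n)%N -> `|f n s - f0 s| < d) ->
  0 < e -> exists n, `|lam (f n) - lam f0| < e.
Proof.
move=> cf cf0 fM f0M M0 flim e0.
pose g n s := `|f n s - f0 s|.
have cg n : continuous (g n) by apply/continuous_fnorm/continuous_fsub.
have gM n s : g n s <= M + M by rewrite (le_trans (ler_normB _ _))// lerD.
have [||n ng] := @gauge_limit g (M + M) e cg _ _ flim e0.
- by move=> n s; rewrite normr_ge0/=.
- by rewrite addr_ge0.
have lamB u v : continuous u -> continuous v -> lam (fun s => u s - v s) = lam u - lam v.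
  move=> cu cv; apply/eqP; rewrite eq_sym subr_eq -lamD//; last exact: continuous_fsub.
  by apply/eqP; congr lam; apply/funext => s; rewrite subrK.
exists n; apply: le_lt_trans ng; rewrite ler_norml lerNl opprB -!lamB//.
apply/andP; split; apply: (@le_gauge _ _ (M + M)) => //; rewrite ?addr_ge0//.
- exact: continuous_fsub.
- by move=> s; rewrite distrC.
- exact: continuous_fsub.
Qed.

End bounded_convergence.

(** * Grothendieck's theorem on pointwise compact sets *)

Lemma natSinv_small (R : realType) (d : R) : 0 < d ->
  exists N, forall n, (N <= n)%N -> n.+1%:R^-1 < d.
Proof.
move=> d0; have [N _ NP] := near_infty_natSinv_lt (PosNum d0).
by exists N => n /NP.
Qed.

Lemma eq_dist_small (R : realType) (x y : R) :
  (forall d : R, 0 < d -> `|x - y| < d) -> x = y.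
Proof.
move=> xy; apply/eqP; rewrite -subr_eq0 -normr_eq0 -[_ == 0]negbK; apply/negP => n0.
by have := xy `|x - y|; rewrite ltxx lt0r n0 normr_ge0 => /(_ isT).
Qed.

Lemma dist_half (R : realType) (x y z e : R) :
  `|x - y| < e / 2 -> `|x - z| < e / 2 -> `|y - z| < e.
Proof.
by rewrite !ltr_norml => /andP[? ?] /andP[? ?]; apply/andP; split; lra.
Qed.

Lemma nbhs_ptws_lt (R : realType) (S : topologicalType) (q : {ptws S -> R}) (s : S)
    (e : R) : 0 < e -> nbhs q [set g : {ptws S -> R} | `|g s - q s| < e].
Proof.
move=> e0; apply: (@nbhs_real_lt R {ptws S -> R} (fun g => g s)) => //.
exact: (@proj_continuous S (fun=> R)).
Qed.

Section grothendieck.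
Context {R : realType} {S : topologicalType}.
Hypothesis cS : compact [set: S].

Lemma finite_net (fs : seq (S -> R)) (d : R) :
  (forall f, f \in fs -> continuous f) -> 0 < d ->
  exists A : seq S, forall s, exists2 t, t \in A &
    forall f, f \in fs -> `|f t - f s| < d.
Proof.
move=> cfs d0.
suff [A AP] : exists A : seq S, forall s, [set: S] s -> exists2 t, t \in A &
    forall f, f \in fs -> `|f t - f s| < d by exists A => s; exact: AP.
apply: (@compact_ind S setT (fun U => exists A : seq S, forall s, U s ->
   exists2 t, t \in A & forall f, f \in fs -> `|f t - f s| < d) cS).
- by exists [::].
- by move=> U V UV [A AP]; exists A => s /UV; exact: AP.
- move=> U V [A AP] [B BP]; exists (A ++ B) => s [/AP|/BP] [t tA tP]; exists t => //.
    by rewrite mem_cat tA.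
  by rewrite mem_cat tA orbT.
move=> s _; exists [set t | forall f, f \in fs -> `|f t - f s| < d]; last first.
  exists [:: s] => t tP; exists s; first by rewrite inE.
  by move=> f ffs; rewrite distrC; exact: tP.
elim: fs cfs => [|f fs IH] cfs; first by apply: filterS filterT.
have /IH IHfs : forall g, g \in fs -> continuous g.
  by move=> g gfs; apply: cfs; rewrite inE gfs orbT.
have cf : continuous f by apply: cfs; rewrite inE eqxx.
move: IHfs; apply: filterS2 (nbhs_real_lt (cf s) d0) => t /= tf tfs g.
by rewrite inE => /orP[/eqP->//|]; exact: tfs.
Qed.

Variables (lam : (S -> R) -> R) (C : R).
Hypothesis lamD : forall f g : S -> R, continuous f -> continuous g ->
  lam (fun s => f s + g s) = lam f + lam g.
Hypothesis lam_le : forall (f : S -> R) (M : R), continuous f -> 0 <= M ->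
  (forall s, `|f s| <= M) -> `|lam f| <= C * M.

(** This is continuity of [lam] at [f0] on [H] for the pointwise topology. If it failed, an
    inductive choice would give functions of [H] that tend to [f0] on a countable set of points
    while [lam] stays [e] away. An interchange of limits carries the convergence to all points,
    against [bounded_convergence]. *)
Lemma grothendieck_finite (H : set (S -> R)) (M : R) (f0 : S -> R) (e : R) :
  compact (H : set {ptws S -> R}) -> (forall f, H f -> continuous f) ->
  0 <= M -> (forall f, H f -> forall s, `|f s| <= M) -> H f0 -> 0 < e ->
  exists (l : seq S) (d : R), 0 < d /\ forall f, H f ->
    (forall s, s \in l -> `|f s - f0 s| < d) -> `|lam f - lam f0| < e.
Proof.
move=> cH ctH M0 HM Hf0 e0; apply: contrapT => nex.
(* A counterexample for every finite set of points and every tolerance [1 / (n + 1)]. *)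
have /choice[pick pickP] (u : seq S * nat) : exists f, [/\ H f,
    forall s, s \in u.1 -> `|f s - f0 s| < u.2.+1%:R^-1 & e <= `|lam f - lam f0|].
  apply: contrapT => nf; apply: nex; exists u.1, u.2.+1%:R^-1; split=> // f Hf fl.
  by rewrite ltNge; apply/negP => ef; apply: nf; exists f.
have /choice[net netP] (u : seq (S -> R) * nat) : exists A : seq S,
    (forall f, f \in u.1 -> H f) -> forall s, exists2 t, t \in A &
    forall f, f \in u.1 -> `|f t - f s| < u.2.+1%:R^-1.
  have [Hu|nHu] := pselect (forall f, f \in u.1 -> H f); last by exists [::].
  have [||A AP] := @finite_net u.1 u.2.+1%:R^-1; last by exists A.
    by move=> f /Hu; exact: ctH.
  by rewrite invr_gt0.
(* A state consists of the functions and the points chosen so far. A step adds a counterexample for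
   the present points, then a net for all present functions. *)
pose step n (u : seq (S -> R) * seq S) :=
  let fs := pick (u.2, n) :: u.1 in (fs, net (fs, n) ++ u.2).
pose st := fix st n := if n is n'.+1 then step n' (st n') else ([:: f0], [::]).
pose f n := pick ((st n).2, n).
have stH n g : g \in (st n).1 -> H g.
  elim: n g => [|n IH] g /=; first by rewrite inE => /eqP->.
  by rewrite inE => /orP[/eqP->|/IH//]; case: (pickP ((st n).2, n)).
have f0st n : f0 \in (st n).1.
  by elim: n => [|n IH] /=; rewrite inE ?eqxx// IH orbT.
have fst n : f n \in (st n.+1).1 by rewrite /= inE eqxx.
have stmono m n a : (m <= n)%N -> a \in (st m).2 -> a \in (st n).2.
  by move=> /subnK <- am; elim: (n - m)%N => //= i IH; rewrite mem_cat IH orbT.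
have stmono1 m n g : (m <= n)%N -> g \in (st m).1 -> g \in (st n).1.
  by move=> /subnK <- am; elim: (n - m)%N => //= i IH; rewrite inE IH orbT.
have fH n : H (f n) by case: (pickP ((st n).2, n)).
have fclose m n a : (m <= n)%N -> a \in (st m).2 -> `|f n a - f0 a| < n.+1%:R^-1.
  by move=> mn am; case: (pickP ((st n).2, n)) => _ fn _; apply: fn; exact: stmono am.
have flim s (d : R) : 0 < d -> exists N, forall n, (N <= n)%N -> `|f n s - f0 s| < d.
  move=> d0; apply: contrapT => nN.
  have far N : exists2 n, (N <= n)%N & d <= `|f n s - f0 s|.
    apply: contrapT => nn; apply: nN; exists N => n Nn.
    by rewrite ltNge; apply/negP => dn; apply: nn; exists n.
  (* The indices [n] with [d <= |f n s - f0 s|] are cofinal; [G] is generated by the tails of [f]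
     along them, and it clusters at some [q] in [H]. The points chosen by the construction cannot
     tell [q] from [f0]. *)
  pose G : set_system {ptws S -> R} := [set X | exists N, forall n, (N <= n)%N ->
    d <= `|f n s - f0 s| -> X (f n)].
  have FG : ProperFilter G.
    apply: Build_ProperFilter.
      by move=> [N NP]; have [n Nn dn] := far N; exact: NP dn.
    split; first by exists 0%N.
      move=> X Y [N NP] [N' NP']; exists (maxn N N') => n.
      by rewrite geq_max => /andP[Nn N'n] dn; split; [exact: NP|exact: NP'].
    by move=> X Y XY [N NP]; exists N => n Nn dn; apply: XY; exact: NP.
  have GH : G H by exists 0%N => n _ _; exact: fH.
  have [q [Hq clq]] := cH G FG GH.
  have Gclose N a c (eta : R) : 0 < eta -> exists n, [/\ (N <= n)%N,
      d <= `|f n s - f0 s|, `|f n a - q a| < eta & `|f n c - q c| < eta].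
    move=> eta0.
    have GN : G [set f n | n in [set n | (N <= n)%N /\ d <= `|f n s - f0 s|]].
      by exists N => n Nn dn; exists n.
    have nq := @filterI _ _ (nbhs_filter q) _ _
      (@nbhs_ptws_lt R S q a eta eta0) (@nbhs_ptws_lt R S q c eta eta0).
    by have [_ [[n [Nn dn] <-] [fa fc]]] := clq _ _ GN nq; exists n.
  have qA n a : a \in (st n).2 -> q a = f0 a.
    move=> an; apply: eq_dist_small => eta eta0.
    have [N NP] := @natSinv_small R (eta / 2) ltac:(lra).
    have [m [+ _ ma _]] := @Gclose (maxn n N) a a (eta / 2) ltac:(lra).
    rewrite geq_max => /andP[/fclose/(_ an) fma /NP mN].
    exact: dist_half ma (lt_trans fma mN).
  (* The net points [t n] imitate [s] better and better on the functions chosen so far. At a cluster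
     point [p] of them, every chosen function takes its value at [s]. *)
  have /choice[t tP] (n : nat) : exists t : S, t \in (st n.+1).2 /\
      forall g, g \in (st n.+1).1 -> `|g t - g s| < n.+1%:R^-1.
    have [//|t tA tg] := netP ((st n.+1).1, n) _ s; first exact: stH.
    by exists t; split=> //=; rewrite mem_cat tA.
  have [p [_ clp]] : setT `&` cluster (t @ \oo) !=set0 by apply: cS; exact: filterT.
  have tclose N (g : S -> R) (h : S -> R) (eta : R) : continuous g -> continuous h ->
      0 < eta -> exists2 n, (N <= n)%N & `|g (t n) - g p| < eta /\ `|h (t n) - h p| < eta.
    move=> cg ch eta0.
    have tN : (t @ \oo) [set t n | n in [set n | (N <= n)%N]].
      by exists N => // n Nn; exists n.
    have np := @filterI _ _ (nbhs_filter p) _ _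
      (nbhs_real_lt (cg p) eta0) (nbhs_real_lt (ch p) eta0).
    by have [_ [[n Nn <-] []]] := clp _ _ tN np; exists n.
  have gp k g : g \in (st k).1 -> g p = g s.
    move=> gk; have cg := ctH _ (stH _ _ gk); apply: eq_dist_small => eta eta0.
    have [N NP] := @natSinv_small R (eta / 2) ltac:(lra).
    have [n + [gn _]] := @tclose (maxn k N) g g (eta / 2) cg cg ltac:(lra).
    rewrite geq_max => /andP[kn /NP nN'].
    have /(tP n).2 gs : g \in (st n.+1).1 by apply: stmono1 gk; rewrite leqW.
    exact: dist_half gn (lt_trans gs nN').
  (* [q] and [f0] are continuous and agree at the [t n], hence at [p]. As every [f n] has equal
     values at [p] and [s], so has [q]; thus [q s = f0 s], whereas [f n s] comes close to [q s] and
     stays [d] away from [f0 s]. *)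
  have qp : q p = f0 p.
    apply: eq_dist_small => eta eta0.
    have [n _ []] := @tclose 0%N q f0 (eta / 2) (ctH _ Hq) (ctH _ Hf0) ltac:(lra).
    rewrite (qA _ _ (tP n).1).
    exact: dist_half.
  have qs : q p = q s.
    apply: eq_dist_small => eta eta0.
    have [n [_ _]] := @Gclose 0%N p s (eta / 2) ltac:(lra).
    rewrite (gp _ _ (fst n)).
    exact: dist_half.
  have [n [_ + fs _]] := @Gclose 0%N s s d d0.
  by rewrite leNgt => /negP; apply; rewrite -(gp _ _ (f0st 0%N)) -qp qs.
have [n] := @bounded_convergence R S cS lam C lamD lam_le f f0 M e
  (fun n => ctH _ (fH n)) (ctH _ Hf0) (fun n => HM _ (fH n)) (HM _ Hf0) M0 flim e0.
by rewrite ltNge => /negP; apply; case: (pickP ((st n).2, n)).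
Qed.

End grothendieck.

(** * Pointwise compactness and the lattice Stone-Weierstrass theorem *)

(** For fixed [s], a finite maximum of interpolants at pairs [(s, t)] lies above [f - e] and still
    equals [f] at [s]. A finite minimum of such maxima, for varying [s], also lies below [f + e]. *)
Lemma lattice_dense (R : realType) (S : topologicalType) (L : set (S -> R))
    (f : S -> R) (e : R) :
  compact [set: S] -> (forall h, L h -> continuous h) -> L !=set0 ->
  (forall g h, L g -> L h -> L (fun s => Num.max (g s) (h s))) ->
  (forall g h, L g -> L h -> L (fun s => Num.min (g s) (h s))) ->
  continuous f ->
  (forall s t, exists h, [/\ L h, h s = f s & h t = f t]) ->
  0 < e -> exists2 h, L h & forall s, `|h s - f s| < e.
Proof.
move=> cS cL L0 Lmax Lmin cf Lst e0.
have near_t (h : S -> R) t : L h -> h t = f t ->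
    nbhs t [set x | `|h x - f x| < e].
  move=> Lh ht; have := nbhs_real_lt (@continuous_fsub _ _ _ _ (cL h Lh) cf t) e0.
  by apply: (@filterS _ (nbhs t)) => x /=; rewrite ht subrr subr0.
have lower s : exists h, [/\ L h, h s = f s & forall t, [set: S] t -> f t - e < h t].
  apply: (@compact_ind S setT (fun U => exists h, [/\ L h, h s = f s &
    forall t, U t -> f t - e < h t]) cS).
  - by have [h [Lh hs _]] := Lst s s; exists h.
  - by move=> U V UV [h [Lh hs hV]]; exists h; split=> // t /UV; exact: hV.
  - move=> U V [h [Lh hs hU]] [g [Lg gs gV]].
    exists (fun t => Num.max (h t) (g t)); split; first exact: Lmax.
      by rewrite hs gs maxxx.
    by move=> t [/hU|/gV] ft; rewrite lt_max ft ?orbT.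
  - move=> t _; have [h [Lh hs ht]] := Lst s t.
    exists [set x | `|h x - f x| < e]; first exact: near_t.
    by exists h; split=> // x /=; rewrite ltr_norml => /andP[+ _]; lra.
suff [h [Lh flt hlt]] : exists h, [/\ L h, forall t, f t - e < h t &
    forall t, [set: S] t -> h t < f t + e].
  exists h => // s; rewrite ltr_norml; apply/andP.
  by have := flt s; have := hlt s I; split; lra.
apply: (@compact_ind S setT (fun U => exists h, [/\ L h, forall t, f t - e < h t &
  forall t, U t -> h t < f t + e]) cS).
(* On the empty space any member of [L] will do, and [L !=set0] provides one. *)
- have [[s _]|S0] := pselect ([set: S] !=set0).
    by have [h [Lh _ fh]] := lower s; exists h; split=> // t; exact: fh.
  by have [h Lh] := L0; exists h; split=> // t; exfalso; apply: S0; exists t.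
- by move=> U V UV [h [Lh hs hV]]; exists h; split=> // t /UV; exact: hV.
- move=> U V [h [Lh hs hU]] [g [Lg gs gV]].
  exists (fun t => Num.min (h t) (g t)); split; first exact: Lmin.
    by move=> t; rewrite lt_min hs gs.
  by move=> t [/hU|/gV] ft; rewrite gt_min ft ?orbT.
- move=> s _; have [h [Lh hs fh]] := lower s.
  exists [set x | `|h x - f x| < e]; first exact: near_t.
  exists h; split=> // [t|x /=]; first exact: fh.
  by rewrite ltr_norml => /andP[_]; lra.
Qed.

Lemma cvg_ptws (I T : Type) (V : topologicalType) (F : set_system T) (phi : T -> I -> V)
    (l : I -> V) : Filter F ->
  (forall i, phi^~ i @ F --> l i) -> phi @ F --> (l : {ptws I -> V}).
Proof.
move=> FF cphi; apply/cvg_sup => i U [_ [[W oW <-] Wl]] /filterS; apply.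
by apply: (cphi i); exact: open_nbhs_nbhs.
Qed.

Lemma continuous_ptws (I : Type) (T V : topologicalType) (phi : T -> {ptws I -> V}) :
  (forall i, continuous (phi^~ i)) -> continuous phi.
Proof. by move=> cphi x; apply: cvg_ptws => i; exact: cphi. Qed.

Lemma compact_image (S T : topologicalType) (f : S -> T) (A : set S) :
  continuous f -> compact A -> compact (f @` A).
Proof. by move=> cf; apply: continuous_compact; exact: continuous_subspaceT. Qed.

Lemma ptws_proj (R : realType) (S : topologicalType) (s : S) :
  continuous (fun f : {ptws S -> R} => f s).
Proof. exact: (@proj_continuous S (fun=> R)). Qed.

Lemma ptws_fst (R : realType) (S T : topologicalType) (s : S) :
  continuous (fun u : {ptws S -> R} * T => u.1 s).
Proof.
move=> u; apply: (@continuous_comp _ _ _ fst (fun f : {ptws S -> R} => f s)).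
  exact: cvg_fst.
exact: ptws_proj.
Qed.

Lemma ptws_snd (R : realType) (S T : topologicalType) (s : S) :
  continuous (fun u : T * {ptws S -> R} => u.2 s).
Proof.
move=> u; apply: (@continuous_comp _ _ _ snd (fun f : {ptws S -> R} => f s)).
  exact: cvg_snd.
exact: ptws_proj.
Qed.

Section pointwise_lattice.
Context {R : realType} {S : topologicalType}.
Implicit Types A B : set (S -> R).

Definition ptws_max A : set (S -> R) :=
  (fun u : (S -> R) * (S -> R) => (fun s => Num.max (u.1 s) (u.2 s))) @` (A `*` A).

Definition ptws_min A : set (S -> R) :=
  (fun u : (S -> R) * (S -> R) => (fun s => Num.min (u.1 s) (u.2 s))) @` (A `*` A).

(** Confining the scalar to a segment makes this a continuous image of a compact product when [A] is
    compact; all scalars are reached as [M] grows. *)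
Definition ptws_scale (M : R) A : set (S -> R) :=
  (fun u : R * (S -> R) => (fun s => u.1 * u.2 s)) @` (`[- M, M] `*` A).

Definition ptws_shift (M : R) A : set (S -> R) :=
  (fun u : R * (S -> R) => (fun s => u.1 + u.2 s)) @` (`[- M, M] `*` A).

Lemma compact_ptws_max A :
  compact (A : set {ptws S -> R}) -> compact (ptws_max A : set {ptws S -> R}).
Proof.
move=> cA; apply: (@compact_image ({ptws S -> R} * {ptws S -> R})%type {ptws S -> R}).
  apply: continuous_ptws => s; apply: continuous_fmax.
    exact: ptws_fst.
  exact: ptws_snd.
exact: compact_setX.
Qed.

Lemma compact_ptws_min A :
  compact (A : set {ptws S -> R}) -> compact (ptws_min A : set {ptws S -> R}).
Proof.
move=> cA; apply: (@compact_image ({ptws S -> R} * {ptws S -> R})%type {ptws S -> R}).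
  apply: continuous_ptws => s; apply: continuous_fmin.
    exact: ptws_fst.
  exact: ptws_snd.
exact: compact_setX.
Qed.

Lemma compact_ptws_scale M A :
  compact (A : set {ptws S -> R}) -> compact (ptws_scale M A : set {ptws S -> R}).
Proof.
move=> cA; apply: (@compact_image (R * {ptws S -> R})%type {ptws S -> R}).
  apply: continuous_ptws => s; apply: continuous_fmul; last exact: ptws_snd.
  by move=> u; exact: (@cvg_fst _ _ (nbhs u.1) (nbhs u.2)).
by apply: compact_setX => //; exact: segment_compact.
Qed.

Lemma compact_ptws_shift M A :
  compact (A : set {ptws S -> R}) -> compact (ptws_shift M A : set {ptws S -> R}).
Proof.
move=> cA; apply: (@compact_image (R * {ptws S -> R})%type {ptws S -> R}).
  apply: continuous_ptws => s.
  apply: continuous_fadd; last exact: ptws_snd.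
  by move=> u; exact: (@cvg_fst _ _ (nbhs u.1) (nbhs u.2)).
by apply: compact_setX => //; exact: segment_compact.
Qed.

End pointwise_lattice.

(** * Scalars, real parts of functionals, and the dual ball *)

Section scalar_theory.
Context {R : realType} {k : scalar_kind}.
Local Notation F := (scalar_field R k).
Implicit Types (x y : F) (a b : R).

Lemma scalar_re_mk a b : scalar_re (mk_scalar a b : F) = a.
Proof. by rewrite /scalar_re /mk_scalar; case: k. Qed.

Lemma mk_scalar1 : mk_scalar 1 0 = 1 :> F.
Proof. by rewrite /mk_scalar; case: k. Qed.

Lemma rabs_mk a : rabs (mk_scalar a 0 : F) = `|a|.
Proof.
rewrite /rabs /scalar_re /mk_scalar; case: k => //=.
by rewrite expr0n/= addr0 sqrtr_sqr.
Qed.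

Lemma normr_re_le x : `|scalar_re x| <= rabs x.
Proof.
move: x; rewrite /rabs /scalar_re; case: k => //= z.
by have := normc_ge_Re z; rewrite lecE => /andP[].
Qed.

Lemma normr_im_le x : `|scalar_im x| <= rabs x.
Proof.
move: x; rewrite /rabs /scalar_im /scalar_re; case: k => /= [x|[a b] /=].
  by rewrite normr0.
by rewrite -sqrtr_sqr ler_sqrt ?addr_ge0 ?sqr_ge0// lerDr sqr_ge0.
Qed.

Lemma rabs_le_reim x : rabs x <= `|scalar_re x| + `|scalar_im x|.
Proof.
move: x; rewrite /rabs /scalar_im /scalar_re; case: k => /= [x|[a b] /=].
  by rewrite normr0 addr0.
rewrite -[leRHS]ger0_norm ?addr_ge0// -sqrtr_sqr ler_sqrt ?sqr_ge0//.
rewrite -(real_normK (num_real a)) -(real_normK (num_real b)) sqrrD.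
by rewrite lerD2r lerDl mulrn_wge0// mulr_ge0.
Qed.

Lemma rabsN x : rabs (- x) = rabs x.
Proof. by rewrite /rabs normrN. Qed.

Lemma scalar_imD x y : scalar_im (x + y) = scalar_im x + scalar_im y.
Proof.
by rewrite /scalar_im; move: x y; case: k => //= x y; rewrite ?addr0 ?raddfD.
Qed.

Lemma scalar_reZ a x : scalar_re (mk_scalar a 0 * x) = a * scalar_re x.
Proof.
by move: x; rewrite /scalar_re /mk_scalar; case: k => //= -[b c]; rewrite /= mul0r subr0.
Qed.

Lemma le_mk_scalar x a : (`|x| <= mk_scalar a 0) = (rabs x <= a).
Proof.
apply/idP/idP => [/scalar_re_le|/(@mk_scalar_le R k)]; first by rewrite mk_scalarK.
by rewrite rabsE.
Qed.

Lemma mk_scalar_ge0 a : (0 <= mk_scalar a 0 :> F) = (0 <= a).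
Proof.
rewrite -(@mk_scalar0 R k); apply/idP/idP => [/scalar_re_le|/(@mk_scalar_le R k)//].
by rewrite !mk_scalarK.
Qed.

Lemma mk_scalar_gt0 a : (0 < mk_scalar a 0 :> F) = (0 < a).
Proof.
rewrite !lt0r mk_scalar_ge0; congr (~~ _ && _).
by apply/eqP/eqP => [|->]; rewrite -(@mk_scalar0 R k)// => /mk_scalar_inj.
Qed.

Lemma gt0_scalar x : 0 < x -> exists2 a, 0 < a & x = mk_scalar a 0.
Proof.
by move=> x0; exists (scalar_re x); rewrite -?mk_scalar_gt0 scalar_reK// ltW.
Qed.

End scalar_theory.

Section real_norm.
Context {R : realType} {k : scalar_kind} {V : normedModType (scalar_field R k)}.
Local Notation F := (scalar_field R k).
Implicit Types x y : V.

Lemma rnormE x : mk_scalar (rnorm x) 0 = `|x|.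
Proof. exact: scalar_reK. Qed.

Lemma rnorm_ge0 x : 0 <= rnorm x.
Proof. by rewrite -(@mk_scalar_ge0 R k) rnormE. Qed.

Lemma rnormD x y : rnorm (x + y) <= rnorm x + rnorm y.
Proof. by rewrite /rnorm -scalar_reD; apply: scalar_re_le; exact: ler_normD. Qed.

Lemma rnormZ (a : F) x : rnorm (a *: x) = rabs a * rnorm x.
Proof. by apply: (@mk_scalar_inj R k); rewrite mk_scalarM rabsE !rnormE normrZ. Qed.

Lemma rnorm0 : rnorm (0 : V) = 0.
Proof. by apply: (@mk_scalar_inj R k); rewrite rnormE mk_scalar0 normr0. Qed.

Lemma le_rnorm x (a : R) : (`|x| <= mk_scalar a 0) = (rnorm x <= a).
Proof.
apply/idP/idP => [/scalar_re_le|/(@mk_scalar_le R k)]; first by rewrite mk_scalarK.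
by rewrite rnormE.
Qed.

Lemma lt_rnorm x (a : R) : (`|x| < mk_scalar a 0) = (rnorm x < a).
Proof.
rewrite -rnormE -subr_gt0 -[RHS]subr_gt0 -(@mk_scalar_gt0 R k); congr (0 < _).
apply/eqP; rewrite subr_eq -mk_scalarD subrK//.
Qed.

End real_norm.

Section complexification.
Context {R : realType} {k : scalar_kind} {V : lmodType (scalar_field R k)}.
Local Notation F := (scalar_field R k).
Variable u : V -> R.
Hypothesis uD : forall x y, u (x + y) = u x + u y.
Hypothesis uZ : forall (a : R) x, u (mk_scalar a 0 *: x) = a * u x.

(** The functional [u x - i u (i x)], the only linear one with real part [u]; for real scalars
    [mk_scalar] drops the second term and leaves [u]. *)
Definition complexify (x : V) : F := mk_scalar (u x) (- u (mk_scalar 0 1 *: x)).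

Lemma complexify_re x : scalar_re (complexify x) = u x.
Proof. exact: scalar_re_mk. Qed.

Lemma complexify_linear a x y :
  complexify (a *: x + y) = a * complexify x + complexify y.
Proof.
rewrite /complexify scalerDr !uD opprD.
move: V a x y u uD uZ; rewrite /mk_scalar; case: k => /= W a x y v vD vZ.
  by rewrite vZ.
case: a => p q; have e (z : W) : Complex p q *: z =
    Complex p 0 *: z + Complex q 0 *: (Complex 0 1 *: z).
  rewrite scalerA -scalerDl; congr (_ *: _); apply/eqP.
  by rewrite eq_complex/= !(mulr0, mul0r, mulr1, addr0, add0r, subr0) !eqxx.
have i2 (z : W) : v (Complex 0 1 *: (Complex 0 1 *: z)) = - v z.
  rewrite scalerA -mulN1r -vZ; congr (v (_ *: _)); apply/eqP.
  by rewrite eq_complex/= !(mulr0, mul0r, mulr1, addr0, add0r, subr0, sub0r) !eqxx.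
rewrite (scalerA (Complex 0 1)) mulrC -scalerA !e !vD !vZ i2.
by apply/eqP; rewrite eq_complex/=; apply/andP; split; apply/eqP; ring.
Qed.

Lemma complexify_le (p : V -> R) : (forall x, u x <= p x) ->
  (forall (a : F) x, p (a *: x) = rabs a * p x) -> forall x, rabs (complexify x) <= p x.
Proof.
move=> up pZ x; set c := complexify x.
have [c0|c0] := eqVneq (rabs c) 0.
  (* Only [0 <= p x] is at stake here: both [u x] and [- u x] are at most [p x]. *)
  rewrite c0; have := up (0 *: x); rewrite -(@mk_scalar0 R k) uZ mul0r pZ rabs_mk normr0.
  move=> _; have := up x; have := up (mk_scalar (-1) 0 *: x).
  by rewrite uZ pZ rabs_mk normrN normr1; lra.
have cn0 : c != 0 by apply: contra_neq c0 => ->; exact: rabs0.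
(* A scalar of modulus 1 that rotates [c] to its modulus, so that [u (a *: x)] is [rabs c]. *)
pose a : F := mk_scalar (rabs c) 0 / c.
have ra : rabs a = 1.
  apply: (mulIf c0); rewrite -rabsM /a divfK// rabs_mk mul1r ger0_norm//.
  exact: rabs_ge0.
have <- : u (a *: x) = rabs c.
  rewrite -complexify_re -[a *: x]addr0 complexify_linear -/c /a divfK//.
  rewrite scalar_reD complexify_re mk_scalarK -[0](scale0r x) -(@mk_scalar0 R k) uZ.
  by rewrite mul0r addr0.
by rewrite (le_trans (up _))// pZ ra mul1r.
Qed.

End complexification.

Section functionals.
Context {R : realType} {k : scalar_kind} {X : normedModType (scalar_field R k)}.
Local Notation F := (scalar_field R k).

Lemma dual_of_bound (phi : X -> F^o) (M : R) : linear phi ->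
  (forall x, rabs (phi x) <= M * rnorm x) -> exists d : dual X, d =1 phi.
Proof.
move=> lphi phiM.
suff pd : phi \in @is_functional R k X by exists (Dual pd).
apply/asboolP; split => //.
pose L := GRing.isLinear.Build F X F^o *:%R phi lphi.
pose f : {linear X -> F^o} := HB.pack phi L.
suff bf : bounded_near f (nbhs 0) by exact: (@linear_bounded_continuous _ _ _ f).1 bf.
apply/linear_boundedP; exists (mk_scalar `|M| 0); split.
  by apply: ger0_real; rewrite mk_scalar_ge0.
move=> r Mr x; rewrite (le_trans (y := mk_scalar `|M| 0 * `|x|))//.
  rewrite -(rnormE x) -mk_scalarM le_mk_scalar (le_trans (phiM x))//.
  by rewrite ler_wpM2r ?rnorm_ge0// ler_norm.
by rewrite ler_wpM2r// ltW.
Qed.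

Lemma dual_le (phi : dual X) : exists2 M, 0 <= M & forall x, rabs (phi x) <= M * rnorm x.
Proof.
have /(@linear_bounded_continuous _ _ _ phi)/linear_boundedP :=
  @functional_continuous _ _ _ phi.
move=> /pinfty_ex_gt0[_ /gt0_scalar[M M0 ->] HM]; exists M; first exact: ltW.
by move=> x; rewrite -le_mk_scalar mk_scalarM rnormE; exact: HM.
Qed.

(* By [re_ball_dual], these are the real parts of the functionals of norm at most 1. *)
Definition re_ball : set (X -> R) :=
  [set u | [/\ forall x y, u (x + y) = u x + u y,
               forall (a : R) x, u (mk_scalar a 0 *: x) = a * u x &
               forall x, `|u x| <= rnorm x]].

(** Alaoglu's theorem: the defining conditions are pointwise closed, inside a product of segments
    that is compact by Tychonoff. *)
Lemma compact_re_ball : compact (re_ball : set {ptws X -> R}).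
Proof.
have cball : compact [set f : {ptws X -> R} | forall x, `[- rnorm x, rnorm x]%classic (f x)].
  exact: (@tychonoff X (fun=> R) (fun x => `[- rnorm x, rnorm x]%classic)
    (fun x => @segment_compact R _ _)).
apply: subclosed_compact cball _; last first.
  by move=> u [_ _ ule] x; rewrite /= in_itv/= -ler_norml.
have pc (x : X) : continuous (fun f : {ptws X -> R} => f x) by exact: ptws_proj.
have -> : re_ball = (\bigcap_x \bigcap_y [set u : {ptws X -> R} | u (x + y) - (u x + u y) = 0])
   `&` (\bigcap_(a : R) \bigcap_x [set u : {ptws X -> R} | u (mk_scalar a 0 *: x) - a * u x = 0])
   `&` (\bigcap_x [set u : {ptws X -> R} | `|u x| - rnorm x <= 0]).
  apply/seteqP; split=> u.
    move=> [uD uZ ule]; split; first split.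
    - by move=> x _ y _ /=; rewrite uD subrr.
    - by move=> a _ x _ /=; rewrite uZ subrr.
    - by move=> x _ /=; rewrite subr_le0.
  move=> [[uD uZ] ule]; split.
  - by move=> x y; apply/eqP; rewrite -subr_eq0; apply/eqP; exact: uD.
  - by move=> a x; apply/eqP; rewrite -subr_eq0; apply/eqP; exact: uZ.
  - by move=> x; rewrite -subr_le0; exact: ule.
have cl0 (g : {ptws X -> R} -> R) : continuous g -> closed [set u | g u = 0].
  by move=> cg; apply: (@closed_comp _ _ g [set 0]) => [u _|]; [exact: cg|exact: closed_eq].
have clle (g : {ptws X -> R} -> R) : continuous g -> closed [set u | g u <= 0].
  by move=> cg; apply: (@closed_comp _ _ g [set x | x <= 0]) => [u _|];
    [exact: cg|exact: closed_le].
apply: closedI; first apply: closedI.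
- apply: closed_bigI => x _; apply: closed_bigI => y _; apply: cl0.
  by apply: continuous_fsub; [|apply: continuous_fadd]; exact: pc.
- apply: closed_bigI => a _; apply: closed_bigI => x _; apply: cl0.
  apply: continuous_fsub; first exact: pc.
  by apply: continuous_fmul; [exact: cst_continuous|exact: pc].
- apply: closed_bigI => x _; apply: clle.
  apply: continuous_fsub; last exact: cst_continuous.
  by apply: continuous_fnorm; exact: pc.
Qed.

Lemma re_ball_dual u : re_ball u -> exists phi : dual X, forall x, u x = scalar_re (phi x).
Proof.
move=> [uD uZ ule].
have [|x|phi phiE] := @dual_of_bound (complexify u) 1.
- exact: complexify_linear.
- rewrite mul1r; apply: (@complexify_le _ _ _ u) => // [y|a y]; last exact: rnormZ.
  by rewrite (le_trans (ler_norm _)).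
- by exists phi => x; rewrite phiE complexify_re.
Qed.

Lemma re_ball_separates (x y : X) (phi : dual X) : phi x != phi y ->
  exists u, [/\ re_ball u, `|u x| <= 1, `|u y| <= 1 & u x != u y].
Proof.
move=> phixy; have [M M0 phiM] := dual_le phi.
(* The factor [c] makes the values at [x] and [y] differ by 1, hence their real parts as well.
   Division by [t] brings the functional into the ball and its values at [x] and [y] into [[-1, 1]],
   where clamping will not change them. *)
pose c : F := (phi x - phi y)^-1.
pose t : R := rabs c * M + rabs (c * phi x) + rabs (c * phi y) + 1.
have cM0 : 0 <= rabs c * M by rewrite mulr_ge0// rabs_ge0.
have t0 : 0 < t by rewrite ltr_wpDl// !addr_ge0// rabs_ge0.
pose u z := t^-1 * scalar_re (c * phi z).
have ule z a : rabs (c * phi z) <= t * a -> `|u z| <= a.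
  rewrite normrM gtr0_norm ?invr_gt0// ler_pdivrMl//.
  exact/le_trans/normr_re_le.
exists u; split.
- split=> [z w|a z|z].
  + by rewrite /u -mulrDr -scalar_reD -mulrDr raddfD.
  + by rewrite /u linearZ/= mulrCA scalar_reZ mulrCA.
  + apply: ule; rewrite rabsM (le_trans (ler_wpM2l (rabs_ge0 c) (phiM z)))//.
    rewrite mulrA ler_wpM2r ?rnorm_ge0// /t.
    by have := rabs_ge0 (c * phi x); have := rabs_ge0 (c * phi y); lra.
- by apply: ule; rewrite mulr1 /t; have := rabs_ge0 (c * phi y); lra.
- by apply: ule; rewrite mulr1 /t; have := rabs_ge0 (c * phi x); lra.
- apply/eqP => /(mulfI _); rewrite invr_eq0 gt_eqF// => /(_ isT)/eqP.
  rewrite -subr_eq0 -scalar_reB -mulrBr mulVf ?subr_eq0//.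
  by rewrite -mk_scalar1 mk_scalarK oner_eq0.
Qed.

End functionals.

(** * Generating C(S) for an Eberlein compactum S *)

Lemma compact_set_type (T : topologicalType) (W : set T) :
  compact W -> compact [set: set_type W].
Proof.
move=> cW G FG _.
have [|w [Ww clw]] := cW (set_val @ G) _.
  by apply: (@filterS _ G _ setT); [move=> x _ /=; exact: set_valP | exact: filterT].
exists (exist _ w (mem_set Ww)); split=> // A B GA [_ [[Z oZ <-] Zw] ZB].
have [|_ [[a Aa <-] Za] ] := clw (set_val @` A) Z _ (open_nbhs_nbhs (conj oZ Zw)).
  by apply: (@filterS _ G _ A) => // a Aa; exists a.
by exists a; split=> //; exact: ZB.
Qed.

Section eberlein.
Context {R : realType} {k : scalar_kind} {S : topologicalType}.

Lemma eberlein_compact : eberlein_compactum R k S -> compact [set: S].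
Proof.
move=> [E [W [/compact_set_type cW [f [g [fK gK cf cg] ] ] ] ] ].
have -> : [set: S] = g @` setT by apply/seteqP; split=> // s _; exists (f s).
exact: compact_image.
Qed.

Lemma eberlein_generated : hausdorff_space S -> eberlein_compactum R k S ->
  exists A : nat -> set (S -> R),
    [/\ forall n, compact (A n : set {ptws S -> R}),
        forall n h, A n h -> continuous h,
        forall n, exists2 M, 0 <= M & forall h, A n h -> forall s, `|h s| <= M &
        forall (f : S -> R) (e : R), continuous f -> 0 < e ->
          exists n, exists2 h, A n h & forall s, `|h s - f s| < e].
Proof.
move=> hS eS; have cS := eberlein_compact eS.
move: eS => [E [W [cW [f [g [fK gK cf cg]]]]]].
pose w s : E := set_val (f s).
(* Clamping makes the functions uniformly bounded without appeal to the
   uniform boundedness principle. *)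
pose clamp (u : E -> R) s := Num.max (- 1) (Num.min 1 (u (w s))).
have clampE u s : `|u (w s)| <= 1 -> clamp u s = u (w s).
  by rewrite ler_norml /clamp => /andP[? ?]; rewrite min_r// max_r.
have clamp_cont u : re_ball u -> continuous (clamp u).
  move=> /re_ball_dual[phi uE].
  have cu : continuous (fun s => u (w s)).
    have -> : (fun s => u (w s)) = (@scalar_re R k \o (phi : weak E -> _)) \o (set_val \o f).
      by apply/funext => s; rewrite uE.
    move=> s; apply: continuous_comp; last first.
      apply: continuous_comp; last exact: scalar_re_continuous.
      exact: weak_functional_continuous.
    by apply: continuous_comp; [exact: cf | exact: initial_continuous].
  apply: continuous_fmax; first exact: cst_continuous.
  by apply: continuous_fmin => //; exact: cst_continuous.
have separated s t : s <> t -> exists u, [/\ re_ball u, `|u (w s)| <= 1,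
    `|u (w t)| <= 1 & u (w s) != u (w t)].
  move=> st; have [phi phist] : exists phi : dual E, phi (w s) != phi (w t).
    (* The weak topology is initial for the functionals: if none separates [w s] from [w t], the two
       have the same neighbourhoods, and then [s = t] in the Hausdorff space [S]. *)
    apply: contrapT => nphi; apply: st; apply: hS => A B As Bt.
    have ev : (fun phi : dual E => phi (w s)) = (fun phi : dual E => phi (w t)).
      by apply/funext => phi; apply/eqP/negPn/negP => p; apply: nphi; exists phi.
    have : nbhs (f s) (g @^-1` A) by apply: cg; rewrite fK.
    move=> [_ [[Z + <-] Zs] ZA]; rewrite openE => /(_ _ Zs).
    move=> [_ [[V oV <-] Vs] VZ]; exists t; split; last exact: nbhs_singleton.
    by rewrite -(fK t); apply/ZA/VZ; rewrite /= -[X in V X]ev.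
  exact: re_ball_separates phist.
(* Coefficients at stage [n'.+1] are bounded by [n'], which keeps each stage compact, while the
   union of the stages admits all affine maps. The stages increase because [Num.max h h = h]. *)
pose A := fix A n := if n is n'.+1 then
  ptws_max (A n') `|` (ptws_min (A n') `|` ptws_shift n'%:R (ptws_scale n'%:R (A n')))
  else clamp @` re_ball.
have cA n : compact (A n : set {ptws S -> R}).
  elim: n => [|n IH] /=.
    apply: (@compact_image {ptws E -> R} {ptws S -> R}); last exact: compact_re_ball.
    apply: continuous_ptws => s; apply: continuous_fmax; first exact: cst_continuous.
    by apply: continuous_fmin; [exact: cst_continuous | exact: ptws_proj].
  apply: compactU; first exact: compact_ptws_max.
  apply: compactU; first exact: compact_ptws_min.
  by apply: compact_ptws_shift; exact: compact_ptws_scale.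
have ctA n h : A n h -> continuous h.
  elim: n h => [|n IH] h /=; first by move=> [u uB <-]; exact: clamp_cont.
  move=> [[[a b] [/IH ca /IH cb] <-]|[[[a b] [/IH ca /IH cb] <-]|]].
  - exact: continuous_fmax.
  - exact: continuous_fmin.
  move=> [[a _] [_ [[b v] [_ /IH cv] <-]] <-] /=.
  apply: continuous_fadd; first exact: cst_continuous.
  by apply: continuous_fmul => //; exact: cst_continuous.
have AM n : exists2 M, 0 <= M & forall h, A n h -> forall s, `|h s| <= M.
  elim: n => [|n [M M0 IH]] /=.
    exists 1 => // _ [u uB <-] s; rewrite ler_norml /clamp le_max lexx/=.
    by rewrite ge_max ge_min lexx andbT; lra.
  exists (n%:R + n%:R * M + M); first by rewrite !addr_ge0// mulr_ge0.
  have M' : M <= n%:R + n%:R * M + M by rewrite lerDr addr_ge0// mulr_ge0.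
  move=> h + s; move=> [[[a b] [/IH ca /IH cb] <-]|[[[a b] [/IH ca /IH cb] <-]|]] /=.
  - by rewrite (le_trans _ M')// /Num.max; case: ifP.
  - by rewrite (le_trans _ M')// /Num.min; case: ifP.
  move=> [[a _] [/= aI [[b v] [/= bI /IH /(_ s) vM] <-]] <-] /=.
  rewrite ler_wpDr// (le_trans (ler_normD _ _))//.
  move: aI bI; rewrite /= !in_itv/= -!ler_norml => aI bI.
  by rewrite lerD// normrM ler_pM.
have Amono m n h : (m <= n)%N -> A m h -> A n h.
  move=> /subnK <- Amh; elim: (n - m)%N => //= i IH; left.
  by exists (h, h) => //; apply/funext => s /=; rewrite maxxx.
exists A; split=> // phi e cphi e0.
suff [h [n Anh] hphi] : exists2 h, (\bigcup_n A n) h & forall s, `|h s - phi s| < e.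
  by exists n, h.
have Amax g0 h : (\bigcup_n A n) g0 -> (\bigcup_n A n) h ->
    exists n, A n g0 /\ A n h.
  move=> [i _ Ai] [j _ Aj]; exists (maxn i j).
  by split; [exact: Amono (leq_maxl _ _) Ai | exact: Amono (leq_maxr _ _) Aj].
have zeroA : A 0%N (clamp (fun=> 0)).
  exists (fun=> 0) => //; split=> [x y|a x|x]; rewrite ?addr0 ?mulr0//.
  by rewrite normr0 rnorm_ge0.
have Aaffine a b h n : A n h -> (\bigcup_n A n) (fun s => a + b * h s).
  move=> Anh.
  have [N [nN aN bN]] : exists N, [/\ (n <= N)%N, `|a| <= N%:R & `|b| <= N%:R].
    exists (n + Num.truncn `|a| + Num.truncn `|b|).+1; split.
    - by rewrite -addnA leqW// leq_addr.
    - rewrite ltW// (lt_le_trans (truncnS_gt _))// ler_nat ltnS.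
      by rewrite addnAC leq_addl.
    - by rewrite ltW// (lt_le_trans (truncnS_gt _))// ler_nat ltnS leq_addl.
  exists N.+1 => //=; right; right.
  exists (a, (fun s => b * h s)) => //=; split; first by rewrite /= in_itv/= -ler_norml.
  by exists (b, h) => //=; split; [rewrite /= in_itv/= -ler_norml | exact: Amono Anh].
apply: lattice_dense => //.
- by move=> h [n _]; exact: ctA.
- by exists (clamp (fun=> 0)), 0%N.
- move=> g0 h /Amax/[apply] -[n [An0 Anh]]; exists n.+1 => //=; left.
  by exists (g0, h).
- move=> g0 h /Amax/[apply] -[n [An0 Anh]]; exists n.+1 => //=; right; left.
  by exists (g0, h).
- move=> s t; have [<-|/eqP st] := eqVneq s t.
    exists (fun x => phi s + 0 * clamp (fun=> 0) x).
    by split; [exact: Aaffine zeroA | rewrite mul0r addr0|rewrite mul0r addr0].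
  have [u [uB us ut ust]] := separated s t st.
  (* The slope of the affine map that sends [u (w s)] to [phi s] and [u (w t)] to [phi t]. *)
  pose b := (phi t - phi s) / (u (w t) - u (w s)).
  exists (fun x => (phi s - b * u (w s)) + b * clamp u x); split.
  - by apply: (Aaffine _ _ _ 0%N); exists u.
  - by rewrite clampE// subrK.
  - rewrite clampE//.
    have -> : phi s - b * u (w s) + b * u (w t) = phi s + b * (u (w t) - u (w s)) by ring.
    by rewrite divfK ?subr_eq0 1?eq_sym// addrC subrK.
Qed.

End eberlein.

(** * Hahn-Banach *)

Section hahn_banach_real.
Context {R : realType} {V : lmodType R}.
Variable p : V -> R.
Hypothesis pD : forall x y, p (x + y) <= p x + p y.
Hypothesis pZ : forall (r : R) x, 0 < r -> p (r *: x) = r * p x.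
Implicit Types G : set (V * R).

(** Partial linear functionals are handled as relations; domination by [p] by itself forces a single
    value at each point, see [uniq] below. *)
Let dominated_graph G :=
  [/\ G (0, 0),
      forall (r : R) u v, G u -> G v -> G (r *: u.1 + v.1, r * u.2 + v.2) &
      forall u, G u -> u.2 <= p u.1].

(** The value [c] at [x0] has to lie between all [u.2 - p (u.1 - x0)] and all [p (v.1 + x0) - v.2];
    subadditivity of [p] puts these in the right order. *)
Lemma dominated_graph_extend G x0 : dominated_graph G ->
  exists H, [/\ dominated_graph H, G `<=` H & exists c, H (x0, c)].
Proof.
move=> [G0 GL Gp].
have key u v : G u -> G v -> u.2 - p (u.1 - x0) <= p (v.1 + x0) - v.2.
  move=> Gu Gv; rewrite lerBrDr addrAC lerBlDr.
  have := Gp _ (GL 1 _ _ Gu Gv); rewrite /= scale1r mul1r => /le_trans; apply.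
  apply: le_trans (pD _ _).
  by rewrite addrACA subrr addr0 addrC.
pose B := [set u.2 - p (u.1 - x0) | u in G].
have supB : has_sup B.
  split; first by exists (0 - p (0 - x0)), (0, 0).
  by exists (p (0 + x0) - 0) => _ [u Gu <-]; exact: (key u (0, 0)).
pose c := sup B.
have c_ge u : G u -> u.2 - p (u.1 - x0) <= c.
  by move=> Gu; apply: ub_le_sup; [case: supB | exists u].
have c_le v : G v -> c <= p (v.1 + x0) - v.2.
  by move=> Gv; apply: ge_sup; [case: supB | move=> _ [u Gu <-]; exact: key].
have GZ (r : R) u : G u -> G (r *: u.1, r * u.2).
  by move=> Gu; have := GL r _ _ Gu G0; rewrite /= !addr0.
exists [set w | exists t : R, exists2 u, G u & w = (u.1 + t *: x0, u.2 + t * c)].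
split; [split| |].
- by exists 0, (0, 0); rewrite //= scale0r mul0r !addr0.
- move=> r _ _ [t [u Gu ->]] [t' [v Gv ->]].
  exists (r * t + t'), (r *: u.1 + v.1, r * u.2 + v.2); first exact: GL.
  rewrite /= scalerDr scalerDl scalerA addrACA; congr pair; ring.
- move=> _ [t [u Gu ->]] /=.
  (* Division by the modulus of [t] reduces the two signs to the two bounds on [c]. *)
  have [t0|t0|->] := ltgtP t 0; last by rewrite scale0r mul0r !addr0; exact: Gp.
  + have s0 : 0 < - t by rewrite oppr_gt0.
    have := c_ge _ (GZ (- t)^-1 _ Gu); rewrite -(ler_pM2l s0) mulrBr /=.
    rewrite -pZ// scalerBr scalerA mulrA divff ?gt_eqF// scale1r mul1r scaleNr opprK.
    by lra.
  + have := c_le _ (GZ t^-1 _ Gu); rewrite -(ler_pM2l t0) mulrBr /=.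
    rewrite -pZ// scalerDr scalerA mulrA divff ?gt_eqF// scale1r mul1r.
    by lra.
- by move=> [x a] Gxa; exists 0, (x, a); rewrite //= scale0r mul0r !addr0.
- by exists c, 1, (0, 0); rewrite //= scale1r mul1r !add0r.
Qed.

Theorem hahn_banach_real (A : set V) (f : V -> R) :
  A 0 -> (forall (r : R) x y, A x -> A y -> A (r *: x + y)) ->
  (forall (r : R) x y, A x -> A y -> f (r *: x + y) = r * f x + f y) ->
  (forall x, A x -> f x <= p x) ->
  exists g : V -> R, [/\ forall (r : R) x y, g (r *: x + y) = r * g x + g y,
    forall x, A x -> g x = f x & forall x, g x <= p x].
Proof.
move=> A0 AL fL fp.
have f0 : f 0 = 0.
  by have := fL 1 0 0 A0 A0; rewrite scaler0 addr0; lra.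
pose G0 : set (V * R) := [set u | A u.1 /\ u.2 = f u.1].
have dG0 : dominated_graph G0.
  split; first by split => //=; rewrite f0.
    by move=> r u v [Au uf] [Av vf]; split => /=; [exact: AL | rewrite fL// uf vf].
  by move=> u [Au ->]; exact: fp.
(* Adjoining [G0] inside the condition covers the empty chain, whose union is [set0], and makes the
   maximal relation extend [f]. *)
have [F FF totF|M [dM maxM]] := @Zorn_bigcup _ [set G | dominated_graph (G `|` G0)].
  have [[G1 FG1]|F0] := pselect (F !=set0); last first.
    rewrite /= (_ : \bigcup_(X in F) X = set0) ?set0U//.
    by apply/seteqP; split=> // x [X FX _]; apply: F0; exists X.
  pose U := \bigcup_(X in F) X `|` G0.
  have single u : U u -> exists2 G, F G & (G `|` G0) u.
    by move=> [[G FG Gu]|G0u]; [exists G => //; left | exists G1 => //; right].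
  have sub G : F G -> G `|` G0 `<=` U.
    by move=> FG u [Gu|?]; [left; exists G | right].
  split.
  - by right; case: dG0.
  - move=> r u v /single[G FG Gu] /single[H FH Hv].
    have [GH|HG] := totF _ _ FG FH.
      apply: (sub _ FH); have [_ HL _] := FF _ FH; apply: HL => //.
      by case: Gu => [/GH|]; [left|right].
    apply: (sub _ FG); have [_ GL _] := FF _ FG; apply: GL => //.
    by case: Hv => [/HG|]; [left|right].
  - by move=> u /single[G FG]; have [_ _] := FF _ FG; exact.
have dom x : exists c, (M `|` G0) (x, c).
  have [H [dH MH [c Hc]]] := dominated_graph_extend x dM.
  have HE : H `|` G0 = H by apply/setUidPl => u G0u; apply: MH; right.
  have [MltH|] := pselect (M `<` H); first by have := maxM _ MltH; rewrite /= HE.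
  move=> nMH; exists c; left; apply: contrapT => nMc; apply: nMH.
  split; first by move=> u Mu; apply: MH; left.
  by move=> /(_ _ Hc).
have /choice[g gP] := dom.
have [D0 DL Dp] := dM.
(* Two values [a] and [b] at [x] put [(0, a - b)] in the relation, and [p 0 = 0] gives [a <= b];
   likewise with the roles exchanged. *)
have uniq x a b : (M `|` G0) (x, a) -> (M `|` G0) (x, b) -> a = b.
  have p0 : p 0 = 0.
    by have := pZ 0 (ltr0Sn R 1); rewrite scaler0; lra.
  have half c d : (M `|` G0) (x, c) -> (M `|` G0) (x, d) -> c <= d.
    move=> xc xd; have := Dp _ (DL (- 1) _ _ xd xc).
    by rewrite /= scaleN1r addNr p0 mulN1r addrC subr_le0.
  by move=> xa xb; apply/eqP; rewrite eq_le !half.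
exists g; split.
- by move=> r x y; apply: uniq (gP _) _; exact: (DL r (x, g x) (y, g y)).
- by move=> x Ax; apply: uniq (gP _) _; right.
- by move=> x; exact: (Dp _ (gP x)).
Qed.

End hahn_banach_real.

Section hahn_banach.
Context {R : realType} {k : scalar_kind}.
Local Notation F := (scalar_field R k).

(** A synonym of [V], to carry the real scalar action without a clash with the action of [F]. *)
Definition realified (V : lmodType F) : Type := V.

Section realified_module.
Variable V : lmodType F.

HB.instance Definition _ := GRing.Zmodule.on (realified V).

Let rscale (r : R) (x : realified V) : realified V := (mk_scalar r 0 : F) *: (x : V).

Let rscaleA a b x : rscale a (rscale b x) = rscale (a * b) x.
Proof. by rewrite /rscale scalerA mk_scalarM. Qed.

Let rscale1 : left_id 1 rscale.
Proof.
move=> x; rewrite /rscale (_ : mk_scalar 1 0 = 1) ?scale1r//.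
by rewrite /mk_scalar; case: (k).
Qed.

Let rscaleDr : right_distributive rscale +%R.
Proof. by move=> a x y; rewrite /rscale scalerDr. Qed.

Let rscaleDl x : {morph rscale^~ x : a b / a + b}.
Proof. by move=> a b; rewrite /rscale mk_scalarD scalerDl. Qed.

HB.instance Definition _ := GRing.Zmodule_isLmodule.Build R (realified V)
  rscaleA rscale1 rscaleDr rscaleDl.

End realified_module.

(** The real part of [f] is extended over the reals and then complexified. The result agrees with
    [f] on [A] because a linear functional is determined by its real part. *)
Theorem hahn_banach (V : lmodType F) (p : V -> R) (A : set V) (f : V -> F) :
  (forall x y, p (x + y) <= p x + p y) ->
  (forall (a : F) x, p (a *: x) = rabs a * p x) ->
  A 0 -> (forall (a : F) x y, A x -> A y -> A (a *: x + y)) ->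
  (forall (a : F) x y, A x -> A y -> f (a *: x + y) = a * f x + f y) ->
  (forall x, A x -> rabs (f x) <= p x) ->
  exists g : V -> F, [/\ forall (a : F) x y, g (a *: x + y) = a * g x + g y,
    forall x, A x -> g x = f x & forall x, rabs (g x) <= p x].
Proof.
move=> pD pZ A0 AL fL fp.
have f0 : f 0 = 0.
  have := fL 1 0 0 A0 A0; rewrite scaler0 addr0 mul1r.
  by move=> /(congr1 (fun t => t - f 0)); rewrite subrr addrK.
have fZ (a : F) x : A x -> f (a *: x) = a * f x.
  by move=> Ax; have := fL a x 0 Ax A0; rewrite f0 !addr0.
have AZ (a : F) x : A x -> A (a *: x).
  by move=> Ax; rewrite -[a *: x]addr0; exact: AL.
have [u [uL uf up]] := @hahn_banach_real R (realified V) p pD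
  (fun r x r0 => etrans (pZ _ x) (congr1 (fun t => t * p x) (etrans (rabs_mk r) (gtr0_norm r0))))
  A (fun x => scalar_re (f x)) A0 (fun r x y => AL _ x y)
  (fun r x y Ax Ay => etrans (congr1 scalar_re (fL _ _ _ Ax Ay))
     (etrans (scalar_reD _ _) (congr1 (fun t => t + scalar_re (f y)) (scalar_reZ r (f x)))))
  (fun x Ax => le_trans (ler_norm _) (le_trans (normr_re_le _) (fp x Ax))).
have uD x y : u (x + y) = u x + u y.
  by have := uL 1 x y; rewrite (scale1r (x : realified V)) mul1r.
have u0 : u 0 = 0.
  by have := uD 0 0; rewrite addr0; lra.
have uZ (r : R) x : u (mk_scalar r 0 *: x) = r * u x.
  by have := uL r x 0; rewrite u0 !addr0.
exists (complexify u); split.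
- exact: complexify_linear.
- move=> x Ax; rewrite /complexify !uf//; last exact: AZ.
  rewrite fZ//; move: (f x); rewrite /mk_scalar /scalar_re; case: (k) => //= -[a b] /=.
  by rewrite mul0r mul1r sub0r opprK.
- exact: complexify_le.
Qed.

End hahn_banach.

(** * Semivariation and functions supported on a small set *)

Lemma continuous_borel_measurable (R : realType) (K : ptopologicalType) (g : K -> R) :
  continuous g -> measurable_fun setT (g : borel K -> R).
Proof.
move=> /continuousP cg; apply: (measurability _ (RGenOpens.measurableE R)).
move=> _ [_ [a [b ->] <-]]; rewrite setTI; apply: sub_sigma_algebra.
by apply: cg; exact: interval_open.
Qed.

Section integral_bounds.
Context {R : realType} d {T : measurableType d}.
Variables (g : T -> R) (L : set T) (M c : R).
Hypotheses (mg : measurable_fun setT g) (mL : measurable L) (M0 : 0 <= M).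
Hypotheses (gL : forall x, ~ L x -> g x = 0) (gM : forall x, `|g x| <= M).

Lemma Rintegral_le_support (m : {measure set T -> \bar R}) :
  (m L <= c%:E)%E -> `|\int[m]_x g x| <= M * c.
Proof.
move=> mLc.
have lee : (`|\int[m]_x (g x)%:E| <= (M * c)%:E)%E.
  apply: (le_trans (le_abse_integral m measurableT _)); first exact/measurable_EFinP.
  apply: (@le_trans _ _ (\int[m]_x (M%:E * (\1_L x)%:E))%E).
    apply: ge0_le_integral => //.
    - by apply/measurable_EFinP/measurableT_comp.
    - by apply/measurable_EFinP/measurable_funM => //; exact: measurable_indic.
    - move=> x _; rewrite abse_EFin -EFinM lee_fin indicE.
      have [Lx|nLx] := pselect (L x); first by rewrite mem_set// mulr1.
      by rewrite gL// normr0 mulr_ge0.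
  rewrite ge0_integralZl//; first by rewrite integral_indic// setIT EFinM lee_wpmul2l.
  exact/measurable_EFinP/measurable_indic.
have fin : (\int[m]_x (g x)%:E)%E \is a fin_num.
  by rewrite fin_num_abs (le_lt_trans lee)// ltry.
by rewrite -lee_fin /Rintegral -abse_EFin fineK.
Qed.

(** At [L] the Jordan parts are the value of [nu] on the part of [L] in [P] and minus its value on
    the part in [N], so each is at most [c]. *)
Lemma jordan_integral_le_support (nu : {charge set T -> \bar R}) :
  (forall B, measurable B -> B `<=` L -> `|fine (nu B)| <= c) ->
  `|jordan_integral nu g| <= M * c + M * c.
Proof.
move=> nuL; rewrite /jordan_integral.
case: cid => -[P N] /= nuPN; have [[mP _] [mN _] _ _] := nuPN.
have finnu B : measurable B -> nu B = (fine (nu B))%:E.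
  by move=> mB; rewrite fineK// fin_num_measure.
rewrite (le_trans (ler_normB _ _))// lerD//; apply: Rintegral_le_support.
  rewrite -[X in (X <= _)%E]/(crestr0 nu mP L) /crestr0 mem_set// /crestr.
  have mLP : measurable (L `&` P) by exact: measurableI.
  rewrite finnu// lee_fin (le_trans (ler_norm _))//.
  exact: nuL.
rewrite -[X in (X <= _)%E]/(cscale (-1) (crestr0 nu mN) L) cscaleN1 /= /crestr0 mem_set// /crestr.
have mLN : measurable (L `&` N) by exact: measurableI.
rewrite finnu// -EFinN lee_fin (le_trans (ler_norm _))// normrN.
exact: nuL.
Qed.

End integral_bounds.

Section semivariation_bound.
Context {R : realType} {k : scalar_kind} {K : ptopologicalType}.
Local Notation F := (scalar_field R k).

(** [B] and its complement in [A] form an admissible partition of [A]. *)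
Lemma total_variation_ge (nu : {charge set (borel K) -> \bar F}) (A B : set (borel K)) :
  measurable A -> measurable B -> B `<=` A ->
  ((rabs (fine (nu B)))%:E <= Defs.total_variation (fine \o nu) A)%E.
Proof.
move=> mA mB BA.
pose P (i : 'I_2) := if val i == 0%N then B else A `\` B.
apply: (@le_trans _ _ (\sum_(i < 2) rabs ((fine \o nu) (P i)))%:E).
  by rewrite lee_fin big_ord_recl big_ord_recl big_ord0 addr0 /= lerDl rabs_ge0.
apply: ereal_sup_ubound; exists 2%N, P; split=> //.
- by move=> i; rewrite /P; case: ifP => // _; exact: measurableD.
- apply/trivIsetP => i j _ _; rewrite /P -val_eqE; case: i j => [[|[|//]] ?] [[|[|//]] ?] //= _.
    by rewrite setIDA setIC setDE -setIA setICr setI0.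
  by rewrite setIC setIDA setIC setDE -setIA setICr setI0.
- apply/seteqP; split=> [x [i _]|x Ax].
    by rewrite /P; case: ifP => _ //; [exact: BA | case].
  have [Bx|nBx] := pselect (B x); first by exists ord0.
  by exists (lift ord0 ord0).
Qed.

(** The factor 8 counts four real integrals, each the difference of two integrals against Jordan
    parts that are at most [M * c]. *)
Lemma scalar_integral_le_support (nu : {charge set (borel K) -> \bar F})
    (f : cfun R k K) (L : set (borel K)) (M c : R) :
  measurable L -> 0 <= M -> (forall x, ~ L x -> f x = 0) ->
  (forall x, rabs (f x) <= M) -> (Defs.total_variation (fine \o nu) L <= c%:E)%E ->
  rabs (scalar_integral nu f) <= 8 * (M * c).
Proof.
move=> mL M0 fL fM tvL.
have cf : continuous (f : K -> F^o) by have /asboolP := cfunP f.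
have nuL B : measurable B -> B `<=` L -> rabs (fine (nu B)) <= c.
  by move=> mB BL; rewrite -lee_fin (le_trans _ tvL)// total_variation_ge.
have mre : measurable_fun setT (scalar_re \o f : borel K -> R).
  apply: continuous_borel_measurable => x; apply: continuous_comp; first exact: cf.
  exact: scalar_re_continuous.
have mim : measurable_fun setT (scalar_im \o f : borel K -> R).
  apply: continuous_borel_measurable => x; apply: continuous_comp; first exact: cf.
  exact: scalar_im_continuous.
have re0 x : ~ L x -> (scalar_re \o f) x = 0.
  by move=> Lx; rewrite /= fL// -(@mk_scalar0 R k) scalar_re_mk.
have im0 x : ~ L x -> (scalar_im \o f) x = 0.
  by move=> Lx; rewrite /= fL// -(subrr 0) scalar_imB subrr.
have reM x : `|(scalar_re \o f) x| <= M by rewrite (le_trans (normr_re_le _)).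
have imM x : `|(scalar_im \o f) x| <= M by rewrite (le_trans (normr_im_le _)).
have nure B : measurable B -> B `<=` L -> `|fine (re_charge nu B)| <= c.
  by move=> mB BL; rewrite (le_trans (normr_re_le _))// nuL.
have nuim B : measurable B -> B `<=` L -> `|fine (im_charge nu B)| <= c.
  by move=> mB BL; rewrite (le_trans (normr_im_le _))// nuL.
rewrite (le_trans (rabs_le_reim _))// scalar_re_mk.
have imE (p q : R) : `|scalar_im (mk_scalar p q : F)| <= `|q|.
  by rewrite /scalar_im /mk_scalar; case: (k) => //=; rewrite normr0.
rewrite (le_trans (lerD (lexx _) (imE _ _)))//.
rewrite (le_trans (lerD (ler_normB _ _) (ler_normD _ _)))//.
have := jordan_integral_le_support mre mL M0 re0 reM nure.
have := jordan_integral_le_support mim mL M0 im0 imM nuim.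
have := jordan_integral_le_support mre mL M0 re0 reM nuim.
have := jordan_integral_le_support mim mL M0 im0 imM nure.
by lra.
Qed.

Lemma semivariation_bound (X : normedModType F) (T : cfun R k K -> X)
    (mu : set (borel K) -> bidual X) (KE L : set K) (c M : R) (xs : dual X)
    (f : cfun R k K) :
  representing_measure T mu -> KE `|` L = [set: K] ->
  measurable (L : set (borel K)) -> (semivariation mu L < c%:E)%E ->
  `|xs| <= 1 -> 0 <= M -> (forall x, KE x -> f x = 0) ->
  (forall x, rabs (f x) <= M) -> rabs (xs (T f)) <= 8 * (M * c).
Proof.
move=> /(_ xs)[nu [[_ nuT] numu]] KEL mL sL xs1 M0 fKE fM.
rewrite [xs (T f)]nuT; apply: (scalar_integral_le_support mL) => //.
  move=> x nLx; apply: fKE; have : [set: K] x by [].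
  by rewrite -KEL => -[].
apply: le_trans (ltW sL); apply: ereal_sup_ubound; exists xs => //.
(* [mu] at [xs] and [nu] agree on Borel sets, and the total variation only looks at Borel
   partitions. *)
congr ereal_sup; apply/seteqP; split=> _ [n [P [mP tP UP ->]]]; exists n, P; split=> //.
  by under eq_bigr do rewrite numu//.
by under [in RHS]eq_bigr do rewrite numu//.
Qed.

End semivariation_bound.

(** * Uniformly closed spans of bounded functions *)

Lemma linear_span_linear (R : realType) (k : scalar_kind)
    (X : lmodType (scalar_field R k)) (W : set X) (a : scalar_field R k) (x y : X) :
  linear_span W x -> linear_span W y -> linear_span W (a *: x + y).
Proof.
move=> [n [b [w [wW ->]]]] [m [c [v [vW ->]]]].
exists (n + m)%N, (fun i => match fintype.split i with inl j => a * b j | inr j => c j end),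
  (fun i => match fintype.split i with inl j => w j | inr j => v j end); split.
  by move=> i; case: (fintype.split i).
rewrite big_split_ord /= scaler_sumr; congr (_ + _); apply: eq_bigr => i _.
  by rewrite (unsplitK (inl i)) scalerA.
by rewrite (unsplitK (inr i)).
Qed.

Lemma linear_span_gen (R : realType) (k : scalar_kind)
    (X : lmodType (scalar_field R k)) (W : set X) (x : X) : W x -> linear_span W x.
Proof.
move=> Wx; exists 1%N, (fun=> 1), (fun=> x); split=> //.
by rewrite big_ord1 scale1r.
Qed.

Section uniform_closed_span.
Context {R : realType} {k : scalar_kind} {I : choiceType}.
Local Notation F := (scalar_field R k).
Variable G : set (I -> F^o).

(** When the members of [G] are bounded, this is their closed linear span in the space of bounded
    functions on [I] with the supremum norm. *)
Definition in_uspan : {pred I -> F^o} := fun g =>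
  `[< (exists M : R, forall i, rabs (g i) <= M) /\
      forall e : R, 0 < e -> exists2 h, linear_span G h &
        forall i, rabs (g i - h i) <= e >].

Lemma in_uspan_submod_closed : submod_closed in_uspan.
Proof.
split.
  apply/asboolP; split; first by exists 0 => i; rewrite rabs0.
  move=> e e0; exists 0; last by move=> i; rewrite subr0 rabs0 ltW.
  by exists 0%N, (fun=> 0), (fun=> 0); split=> [[]//|]; rewrite big_ord0.
move=> a f g /asboolP[[M fM] fG] /asboolP[[N gN] gG]; apply/asboolP; split.
  exists (rabs a * M + N) => i; rewrite (le_trans (rabsD _ _))// lerD//.
  by rewrite rabsM ler_wpM2l// rabs_ge0.
move=> e e0; pose d := e / 2 / (rabs a + 1).
have a1 : 0 < rabs a + 1 by rewrite ltr_wpDl// rabs_ge0.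
have d0 : 0 < d by rewrite divr_gt0// divr_gt0.
have [h Gh fh] := fG d d0; have [h' Gh' gh'] := gG (e / 2) ltac:(lra).
exists (a *: h + h'); first exact: linear_span_linear.
move=> i; rewrite (_ : _ - _ = a * (f i - h i) + (g i - h' i)); last first.
  by rewrite !fctE /= mulrBr opprD addrACA.
rewrite (le_trans (rabsD _ _))// [leRHS](splitr e) lerD// rabsM.
rewrite (le_trans (ler_wpM2l (rabs_ge0 a) (fh i)))//.
have -> : e / 2 = (rabs a + 1) * d by rewrite [RHS]mulrC /d divfK// gt_eqF.
by rewrite ler_wpM2r ?ltW// ltrDl.
Qed.

HB.instance Definition _ :=
  GRing.isSubmodClosed.Build _ _ in_uspan in_uspan_submod_closed.

Record uspan := Uspan { uspan_val :> I -> F^o; uspanP : uspan_val \in in_uspan }.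

HB.instance Definition _ := [isSub for uspan_val].
HB.instance Definition _ := [Choice of uspan by <:].
HB.instance Definition _ := [SubChoice_isSubLmodule of uspan by <:].

Lemma uspan_bounded (g : uspan) : exists M : R, forall i, rabs (g i) <= M.
Proof. by have /asboolP[] := uspanP g. Qed.

Definition unorm (g : uspan) : R := sup [set rabs (g i) | i in [set: I]].

Lemma le_unorm (g : uspan) i : rabs (g i) <= unorm g.
Proof.
apply: ub_le_sup; last by exists i.
by have [M gM] := uspan_bounded g; exists M => _ [j _ <-].
Qed.

Lemma unorm_le (g : uspan) (M : R) : 0 <= M -> (forall i, rabs (g i) <= M) -> unorm g <= M.
Proof.
move=> M0 gM; have [[i _]|I0] := pselect ([set: I] !=set0).
  by apply: ge_sup; [exists (rabs (g i)), i | move=> _ [j _ <-]].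
(* For empty [I] the norm is [sup set0], that is 0. *)
rewrite /unorm (_ : [set _ | _ in _] = set0) ?sup0//.
by apply/seteqP; split=> // t [i _ _]; exfalso; apply: I0; exists i.
Qed.

Lemma unorm_ge0 (g : uspan) : 0 <= unorm g.
Proof.
have [[i _]|I0] := pselect ([set: I] !=set0).
  by rewrite (le_trans _ (le_unorm g i))// rabs_ge0.
rewrite /unorm (_ : [set _ | _ in _] = set0) ?sup0//.
by apply/seteqP; split=> // t [i _ _]; exfalso; apply: I0; exists i.
Qed.

Let norm (g : uspan) : F := mk_scalar (unorm g) 0.

Let normD (f g : uspan) : norm (f + g) <= norm f + norm g.
Proof.
rewrite -mk_scalarD; apply: mk_scalar_le; apply: unorm_le => [|i].
  by rewrite addr_ge0// unorm_ge0.
by rewrite (le_trans (rabsD _ _))// lerD// le_unorm.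
Qed.

Let normZ (a : F) (g : uspan) : norm (a *: g) = `|a| * norm g.
Proof.
rewrite -rabsE -mk_scalarM; congr mk_scalar; apply/eqP; rewrite eq_le.
apply/andP; split.
  apply: unorm_le => [|i]; first by rewrite mulr_ge0 ?unorm_ge0 ?rabs_ge0.
  by rewrite rabsM ler_wpM2l ?rabs_ge0 ?le_unorm.
have [a0|a0] := eqVneq (rabs a) 0; first by rewrite a0 mul0r unorm_ge0.
have {}a0 : 0 < rabs a by rewrite lt0r a0 rabs_ge0.
rewrite mulrC -ler_pdivlMr//; apply: unorm_le => [|i].
  by rewrite divr_ge0 ?unorm_ge0 ?rabs_ge0.
by rewrite ler_pdivlMr// mulrC -rabsM (le_unorm (a *: g)).
Qed.

Let norm0_eq0 (g : uspan) : norm g = 0 -> g = 0.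
Proof.
rewrite -mk_scalar0 => /mk_scalar_inj g0; apply: val_inj; apply/funext => i /=.
by apply: rabs_eq0; apply/eqP; rewrite eq_le rabs_ge0 andbT -g0 le_unorm.
Qed.

HB.instance Definition _ := Lmodule_isNormed.Build F uspan normD normZ norm0_eq0.

Lemma uspan_rnorm (g : uspan) : rnorm g = unorm g.
Proof. exact: mk_scalarK. Qed.

(** Real and imaginary parts converge pointwise by completeness of [R]. The Cauchy estimate passes
    to the limit uniformly in [i], which keeps the limit in the closure of the span. *)
Lemma uspan_complete (FF : set_system uspan) : ProperFilter FF -> cauchy FF -> cvg FF.
Proof.
move=> PF /(@cauchyP F) cF.
have small (e : R) : 0 < e -> exists g : uspan, FF [set h | unorm (g - h) < e].
  move=> e0; have e0' : 0 < mk_scalar e 0 :> F by rewrite mk_scalar_gt0.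
  have [g gF] := cF _ e0'; exists g; apply: filterS gF => h.
  by rewrite -ball_normE /= lt_rnorm uspan_rnorm.
have limit (h : F -> R) : {morph h : x y / x - y} -> (forall x, `|h x| <= rabs x) ->
    exists l : I -> R, forall (e : R) (g : uspan), FF [set h | unorm (g - h) < e] ->
      forall i, `|h (g i) - l i| <= e.
  move=> hB hle.
  have cv i : cvg ((fun g : uspan => h (g i)) @ FF).
    apply: cauchy_cvg; apply/(@cauchyP R) => e e0.
    have [g gF] := small e e0; exists (h (g i)).
    apply: (@filterS _ FF _ _ _ _ gF) => f fe.
    suff : `|h (g i) - h (f i)| < e by [].
    rewrite -hB (le_lt_trans (hle _))//.
    exact: le_lt_trans (le_unorm (g - f) i) fe.
  exists (fun i => lim ((fun g : uspan => h (g i)) @ FF)) => e g ge i.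
  apply/ler_addgt0Pl => d d0.
  have near_lim := (@cvgrPdist_lt _ R^o _ FF (@filter_filter _ FF PF) _ _).1 (cv i) d d0.
  have [f [/= fe fd]] := @filter_ex _ FF _ _ (@filterI _ FF _ _ _ ge near_lim).
  rewrite -(subrKA (h (f i))) (le_trans (ler_normD _ _))// addrC lerD//.
    by rewrite distrC ltW.
  by rewrite -hB (le_trans (hle _))// (le_trans (le_unorm (g - f) i))// ltW.
have [lr lrP] := limit _ scalar_reB normr_re_le.
have [li liP] := limit _ scalar_imB normr_im_le.
pose l i : F := mk_scalar (lr i) (li i).
(* The real and the imaginary part contribute [e] each. *)
have lP (e : R) (g : uspan) : FF [set h | unorm (g - h) < e] ->
    forall i, rabs (g i - l i) <= e + e.
  move=> ge i; rewrite (le_trans (rabs_le_reim _))// scalar_reB scalar_imB.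
  rewrite scalar_re_mk; apply: lerD; first exact: lrP.
  apply: le_trans (liP e g ge i).
  rewrite /l /scalar_im /mk_scalar; case: (k) (g i) => //= x.
  by rewrite subrr normr0.
have lin : (l : I -> F^o) \in in_uspan.
  apply/asboolP; split.
    have [g g1] := small 1 ltr01; have [M gM] := uspan_bounded g.
    exists (1 + 1 + M) => i; have -> : l i = - (g i - l i) + g i by rewrite opprB subrK.
    by rewrite (le_trans (rabsD _ _))// lerD// rabsN lP.
  move=> e e0; have [g ge] := small (e / 4) ltac:(lra).
  have /asboolP[_ /(_ (e / 2) ltac:(lra))[h Gh gh]] := uspanP g.
  exists h => // i; rewrite -(subrKA (g i)) (le_trans (rabsD _ _))//.
  have := lP _ _ ge i; have := gh i; rewrite -(rabsN (g i - l i)) opprB.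
  by lra.
apply/cvg_ex; exists (Uspan lin) => V /nbhs_ballP[_ /gt0_scalar[e e0 ->] eV].
(* The distance from [g] to the limit costs [e / 8] twice and that from [g] to [h] once, in all less
   than [e / 2]. *)
have [g ge] := small (e / 8) ltac:(lra).
apply: (@filterS _ FF _ _ _ _ ge) => h he; apply: eV; rewrite -ball_normE /= lt_rnorm uspan_rnorm.
apply: (@le_lt_trans _ _ (e / 2)); last by lra.
apply: unorm_le => [|i]; first by lra.
have -> : (Uspan lin - h) i = - (g i - l i) + (g i - h i) by rewrite opprB subrKA.
rewrite (le_trans (rabsD _ _))// rabsN.
have := lP _ _ ge i; have : rabs (g i - h i) <= unorm (g - h) := le_unorm (g - h) i.
by move: he => /=; lra.
Qed.

HB.instance Definition _ := Uniform_isComplete.Build uspan uspan_complete.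

End uniform_closed_span.

(** * The weak topology *)

Section weak_convergence.
Context {R : realType} {k : scalar_kind}.
Local Notation F := (scalar_field R k).

Lemma cvg_weak (X : normedModType F) (T : Type) (FF : set_system T)
    (f : T -> X) (l : X) : Filter FF ->
  (forall (phi : dual X) (e : R), 0 < e -> FF [set t | rabs (phi l - phi (f t)) < e]) ->
  f @ FF --> (l : weak X).
Proof.
move=> FFF cf U [_ [[Z oZ <-] Zl] ZU]; apply: (filterS ZU).
have cev : (fun t (phi : dual X) => (phi (f t) : F^o)) @ FF -->
    ((fun phi : dual X => phi l : F^o) : {ptws dual X -> F^o}).
  apply: cvg_ptws => phi; apply/(@cvgrPdist_lt _ F^o _ FF) => _ /gt0_scalar[e e0 ->].
  apply: filterS (cf phi e e0) => t /=.
  by rewrite (@lt_rnorm R k F^o).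
by apply: cev; exact: open_nbhs_nbhs.
Qed.

Lemma nbhs_weak_norm (X : normedModType F) (U : set X) (x : X) :
  nbhs (x : weak X) U -> nbhs x U.
Proof.
move=> xU; have : x @[x --> x] --> (x : weak X); last exact.
apply: cvg_weak => phi e e0.
have e0' : 0 < mk_scalar e 0 :> F by rewrite mk_scalar_gt0.
have := (@cvgrPdist_lt _ F^o _ (nbhs x) (nbhs_filter x) _ _).1
  (@functional_continuous _ _ _ phi x) _ e0'.
by apply: (@filterS _ (nbhs x)) => y /=; rewrite (@lt_rnorm R k F^o).
Qed.

Lemma weak_scale_continuous (X : normedModType F) (c : F) :
  continuous ((fun x => c *: x) : weak X -> weak X).
Proof.
move=> x; apply: (@cvg_weak X X (nbhs (x : weak X)) (fun x => c *: x) (c *: x)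
  (nbhs_filter (x : weak X))) => phi e e0.
have c1 : 0 < rabs c + 1 by rewrite ltr_wpDl// rabs_ge0.
have e0' : 0 < mk_scalar (e / (rabs c + 1)) 0 :> F by rewrite mk_scalar_gt0 divr_gt0.
have := (@cvgrPdist_lt _ F^o _ (nbhs (x : weak X)) (nbhs_filter _) _ _).1
  (@weak_functional_continuous _ _ _ phi x) _ e0'.
apply: (@filterS _ (nbhs (x : weak X))) => y /=; rewrite (@lt_rnorm R k F^o) => phie.
have -> : phi (c *: x) - phi (c *: y) = c * (phi x - phi y) by rewrite mulrBr !linearZ.
rewrite rabsM (le_lt_trans (y := (rabs c + 1) * rabs (phi x - phi y)))//.
  by rewrite ler_wpM2r ?rabs_ge0// lerDl.
by rewrite mulrC -ltr_pdivlMr.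
Qed.

(** A filter on this set either clusters at [x] or avoids a neighbourhood of [x]; in the second case
    it lives on finitely many of the compact sets [V n]. *)
Lemma compact_bigcup_null (T : topologicalType) (V : nat -> set T) (x : T) :
  (forall n, compact (V n)) ->
  (forall U, nbhs x U -> exists N, forall n, (N <= n)%N -> V n `<=` U) ->
  compact ([set x] `|` \bigcup_n V n).
Proof.
move=> cV Vx G FG GA.
have cfin N : compact (\bigcup_(n in [set n | (n < N)%N]) V n).
  elim: N => [|N IH].
    by rewrite (_ : \bigcup_(_ in _) _ = set0); [exact: compact0|apply/seteqP; split=> [y []|]].
  rewrite (_ : \bigcup_(_ in _) _ = V N `|` \bigcup_(n in [set n | (n < N)%N]) V n).
    exact: compactU.
  apply/seteqP; split=> y.
    by move=> [n /=]; rewrite ltnS leq_eqVlt => /orP[/eqP->|nN] Vy; [left|right; exists n].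
  by move=> [Vy|[n /= nN Vy]]; [exists N => //=|exists n => //=; exact: ltnW].
have [clx|nclx] := pselect (cluster G x).
  by exists x; split=> //; left.
have [B [U [GB xU BU]]] : exists B U, [/\ G B, nbhs x U & forall y, B y -> ~ U y].
  apply: contrapT => nBU; apply: nclx => B U GB xU; apply: contrapT => BU; apply: nBU.
  by exists B, U; split=> // y By Uy; apply: BU; exists y.
have [N VN] := Vx U xU.
have GN : G (\bigcup_(n in [set n | (n < N)%N]) V n).
  apply: filterS (filterI GA GB) => y [[->|[n _ Vy]] By].
    by case: (BU _ By); exact: nbhs_singleton.
  exists n => //=; rewrite ltnNge; apply/negP => Nn.
  by case: (BU _ By); exact: VN Vy.
have [y [[n _ Vy] cly]] := cfin N G FG GN.
by exists y; split=> //; right; exists n.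
Qed.

Lemma linear_span_sub (X : lmodType F) (W W' : set X) :
  (forall w, W w -> linear_span W' w) -> linear_span W `<=` linear_span W'.
Proof.
move=> WW' _ [n [a [w [wW ->]]]]; elim: n a w wW => [|n IH] a w wW.
  by rewrite big_ord0; exists 0%N, (fun=> 0), (fun=> 0); split=> [[]//|]; rewrite big_ord0.
by rewrite big_ord_recl; apply: linear_span_linear; [exact: WW'|exact: IH].
Qed.

Lemma WCG_bigcup (Y : completeNormedModType F) (W : nat -> set Y) :
  (forall n, compact (W n : set (weak Y))) ->
  (forall n, exists M : R, forall y, W n y -> rnorm y <= M) ->
  dense (linear_span (\bigcup_n W n)) -> WCG Y.
Proof.
move=> cW /choice[M WM] dW.
(* Scaling by [c n] puts the [n]-th set into the ball of radius [1 / (n + 1)], so that the scaled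
   sets shrink to 0 in norm; as [c n] is nonzero, no generator is lost from the span. *)
pose c n : R := (n.+1%:R * (`|M n| + 1))^-1.
have c0 n : 0 < c n by rewrite invr_gt0 mulr_gt0// ltr_wpDl.
pose V n : set Y := (fun y => (mk_scalar (c n) 0 : F) *: y) @` W n.
exists ([set 0] `|` \bigcup_n V n); split.
  apply: (@compact_bigcup_null (weak Y)) => [n|U /nbhs_weak_norm].
    by apply: compact_image (cW n); exact: weak_scale_continuous.
  move=> /nbhs_ballP[_ /gt0_scalar[e e0 ->] eU]; have [N NP] := natSinv_small e0.
  exists N => n Nn _ [y Wy <-]; apply: eU; rewrite -ball_normE /= sub0r normrN lt_rnorm.
  rewrite rnormZ rabs_mk gtr0_norm// (le_lt_trans _ (NP n Nn))//.
  rewrite /c invfM -mulrA ler_piMr ?invr_ge0// ler_pdivrMl ?ltr_wpDl// mulr1.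
  by rewrite (le_trans (WM n y Wy))// (le_trans (ler_norm _))// lerDl.
move=> B B0 oB; have [y [By spany]] := dW B B0 oB; exists y; split=> //.
apply: linear_span_sub spany => w [n _ Wnw].
have cn0 : (mk_scalar (c n) 0 : F) != 0 by rewrite gt_eqF// mk_scalar_gt0.
rewrite -(scalerK cn0 w) -[X in linear_span _ X]addr0; apply: linear_span_linear.
  by apply: linear_span_gen; right; exists n => //; exists w.
by exists 0%N, (fun=> 0), (fun=> 0); split=> [[]//|]; rewrite big_ord0.
Qed.

Lemma uspan_dense (I : choiceType) (G : set (I -> F^o)) :
  (forall g, G g -> exists M : R, forall i, rabs (g i) <= M) ->
  dense (linear_span [set y : uspan G | G (uspan_val y)]).
Proof.
move=> Gbd B [y By] oB.
have Gin g : G g -> g \in in_uspan G.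
  move=> Gg; apply/asboolP; split; first exact: Gbd.
  move=> e e0; exists g; first exact: linear_span_gen.
  by move=> i; rewrite subrr rabs0 ltW.
have /nbhs_ballP[_ /gt0_scalar[e e0 ->] eB] : nbhs y B by exact: open_nbhs_nbhs.
have /asboolP[_ /(_ (e / 2) ltac:(lra))[h [n [a [w [wG hE]]]] yh]] := uspanP y.
pose v i : uspan G := Uspan (Gin _ (wG i)).
exists (\sum_(i < n) a i *: v i); split; last by exists n, a, v.
apply: eB; rewrite -ball_normE /= lt_rnorm uspan_rnorm.
apply: (@le_lt_trans _ _ (e / 2)); last by lra.
apply: unorm_le => [|i]; first by lra.
apply: le_trans (yh i); rewrite /= hE le_eqVlt; apply/orP; left; apply/eqP.
congr (rabs (_ - _)).
by rewrite -[LHS]/((val (\sum_(i < n) a i *: v i)) i) raddf_sum /=.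
Qed.

End weak_convergence.

(** * Functionals on C(K) and restriction to closed sets *)

Lemma continuous_compact_bounded (R : realType) (S : topologicalType) (g : S -> R) :
  compact [set: S] -> continuous g -> exists M : R, forall s, `|g s| <= M.
Proof.
move=> cS cg; suff [M MP] : exists M : R, forall s, [set: S] s -> `|g s| <= M.
  by exists M => s; exact: MP.
apply: (@compact_ind S setT (fun U => exists M : R, forall s, U s -> `|g s| <= M) cS).
- by exists 0.
- by move=> U V UV [M MP]; exists M => s /UV; exact: MP.
- move=> U V [M MP] [N NP]; exists (Num.max M N) => s [/MP|/NP] gs.
    by rewrite le_max gs.
  by rewrite le_max gs orbT.
move=> s _; exists [set x | `|g x - g s| < 1]; first exact: nbhs_real_lt (cg s) ltr01.
exists (1 + `|g s|) => x /= gx.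
by rewrite -(subrK (g s) (g x)) (le_trans (ler_normD _ _))// lerD2r ltW.
Qed.

Lemma hausdorff_set_type (T : topologicalType) (A : set T) :
  hausdorff_space T -> hausdorff_space (set_type A).
Proof.
move=> hT x y clxy; apply: val_inj; apply: hT => U V xU yV.
have xU' : nbhs x (set_val @^-1` U) by exact: (@initial_continuous A T set_val).
have yV' : nbhs y (set_val @^-1` V) by exact: (@initial_continuous A T set_val).
by have [z [Uz Vz]] := clxy _ _ xU' yV'; exists (set_val z).
Qed.

Lemma cfun_continuous (R : realType) (k : scalar_kind) (K : topologicalType)
    (f : cfun R k K) : continuous (f : K -> (scalar_field R k)^o).
Proof. by have /asboolP := cfunP f. Qed.

Lemma cfun_of_real (R : realType) (k : scalar_kind) (K : topologicalType) (u : K -> R) :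
  continuous u -> exists f : cfun R k K, forall x, f x = mk_scalar (u x) 0.
Proof.
move=> cu.
suff uc : (fun x => mk_scalar (u x) 0 : (scalar_field R k)^o) \in is_cfun.
  by exists (Cfun uc).
apply/asboolP => x; apply/(@cvgrPdist_lt _ (scalar_field R k)^o _ (nbhs x)).
move=> _ /gt0_scalar[e e0 ->].
apply: (@filterS _ (nbhs x)) (nbhs_real_lt (cu x) e0) => y /= uy.
rewrite (@lt_rnorm R k (scalar_field R k)^o) -[rnorm _]/(rabs _).
have -> : mk_scalar (u x) 0 - mk_scalar (u y) 0 = mk_scalar (u x - u y) 0 :> scalar_field R k.
  by apply/eqP; rewrite subr_eq -mk_scalarD subrK.
by rewrite rabs_mk distrC.
Qed.

Section sup_norm_theory.
Context {R : realType} {k : scalar_kind} {K : ptopologicalType}.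
Hypothesis cK : compact [set: K].
Local Notation F := (scalar_field R k).
Implicit Types f g : cfun R k K.

Lemma rabs_le_sup_norm f t : rabs (f t) <= sup_norm f.
Proof.
apply: ub_le_sup; last by exists t.
have [|M fM] := @continuous_compact_bounded R K (scalar_re \o f) cK.
  move=> x; apply: continuous_comp; first exact: cfun_continuous.
  exact: scalar_re_continuous.
have [|N fN] := @continuous_compact_bounded R K (scalar_im \o f) cK.
  move=> x; apply: continuous_comp; first exact: cfun_continuous.
  exact: scalar_im_continuous.
exists (M + N) => _ [x _ <-]; rewrite (le_trans (rabs_le_reim _))// lerD//.
  exact: fM.
exact: fN.
Qed.

Lemma sup_norm_le f (M : R) : (forall t, rabs (f t) <= M) -> sup_norm f <= M.
Proof.
move=> fM; apply: ge_sup; first by exists (rabs (f point)), point.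
by move=> _ [t _ <-].
Qed.

Lemma sup_norm_ge0 f : 0 <= sup_norm f.
Proof. by rewrite (le_trans _ (rabs_le_sup_norm f point))// rabs_ge0. Qed.

Lemma sup_normD f g : sup_norm (f + g) <= sup_norm f + sup_norm g.
Proof.
apply: sup_norm_le => t; rewrite (le_trans (rabsD _ _))//.
by rewrite lerD// rabs_le_sup_norm.
Qed.

Lemma sup_normZ (a : F) f : sup_norm (a *: f) = rabs a * sup_norm f.
Proof.
apply/eqP; rewrite eq_le; apply/andP; split.
  by apply: sup_norm_le => t; rewrite rabsM ler_wpM2l ?rabs_ge0 ?rabs_le_sup_norm.
have [a0|a0] := eqVneq (rabs a) 0; first by rewrite a0 mul0r sup_norm_ge0.
have {}a0 : 0 < rabs a by rewrite lt0r a0 rabs_ge0.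
rewrite mulrC -ler_pdivlMr//; apply: sup_norm_le => t.
by rewrite ler_pdivlMr// mulrC -rabsM (rabs_le_sup_norm (a *: f)).
Qed.

(** Restrict [phi] to the functions vanishing on [A], extend this restriction to [rho] with the same
    bound, and take [phi - rho]. *)
Lemma functional_almost_supported (phi : cfun R k K -> F) (A : set K) (e : R) :
  (forall (a : F) f g, phi (a *: f + g) = a * phi f + phi g) -> 0 <= e ->
  (forall f, (forall x, A x -> f x = 0) -> rabs (phi f) <= e * sup_norm f) ->
  exists tau : cfun R k K -> F,
    [/\ forall (a : F) f g, tau (a *: f + g) = a * tau f + tau g,
        forall f, (forall x, A x -> f x = 0) -> tau f = 0 &
        forall f, rabs (phi f - tau f) <= e * sup_norm f].
Proof.
move=> phiL e0 phiA.
have [||||||rho [rhoL rhoA rho_le]] := @hahn_banach R k (cfun R k K)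
  (fun f => e * sup_norm f) [set f | forall x, A x -> f x = 0] phi.
- by move=> f g; rewrite -mulrDr ler_wpM2l// sup_normD.
- by move=> a f; rewrite sup_normZ mulrCA.
- by [].
- move=> a f g f0 g0 x Ax; rewrite -[LHS]/(a *: f x + g x) f0// g0//.
  by rewrite scaler0 addr0.
- by move=> a f g _ _; exact: phiL.
- exact: phiA.
exists (fun f => phi f - rho f); split.
- by move=> a f g; rewrite phiL rhoL mulrBr opprD addrACA.
- by move=> f f0; rewrite rhoA// subrr.
- by move=> f; rewrite opprB addrC subrK.
Qed.

Hypothesis hK : hausdorff_space K.

Lemma cfun_extension (A : set K) (u : A -> R) (M : R) : closed A -> continuous u ->
  0 <= M -> (forall s, `|u s| <= M) ->
  exists f : cfun R k K, (forall s, f (set_val s) = mk_scalar (u s) 0) /\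
    forall t, rabs (f t) <= M.
Proof.
move=> clA cu M0 uM.
(* The Tietze extension used below asks for a positive bound. *)
have [M0'|M0'] := eqVneq M 0.
  exists 0; split=> [s|t]; last by rewrite rabs0.
  suff -> : u s = 0 by rewrite mk_scalar0.
  by apply/eqP; rewrite -normr_le0 -M0'.
have {M0 M0'}M0 : 0 < M by rewrite lt0r M0' M0.
have wu : {within A, continuous (valL_ 0 u)} by apply/subspace_valL_continuousP'.
have [|g [ug cg gM]] := @continuous_bounded_extension K R (compact_normal hK cK)
  A clA (valL_ 0 u) M M0 wu.
  move=> x Ax; have -> : x = set_val (exist _ x (mem_set Ax) : A) by [].
  by rewrite -[valL_ _ _ _]/((sigL A (valL_ 0 u)) _) valLK.
have [f fE] := @cfun_of_real R k K g cg.
exists f; split=> [s|t]; last by rewrite fE rabs_mk.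
rewrite fE -ug; last by rewrite inE; exact: set_valP.
by rewrite -[valL_ _ _ _]/((sigL A (valL_ 0 u)) _) valLK.
Qed.

End sup_norm_theory.

Section extension_operator.
Context {R : realType} {k : scalar_kind} {K : ptopologicalType} {I : Type}.
Hypotheses (cK : compact [set: K]) (hK : hausdorff_space K).
Local Notation F := (scalar_field R k).
Variables (A : set K) (t : I -> cfun R k K -> F) (C : R).
Hypothesis clA : closed A.
Hypothesis tL : forall i (a : F) (f g : cfun R k K), t i (a *: f + g) = a * t i f + t i g.
Hypothesis tA : forall i (f : cfun R k K), (forall x, A x -> f x = 0) -> t i f = 0.
Hypothesis tC : forall i (f : cfun R k K), rabs (t i f) <= C * sup_norm f.
Hypothesis C0 : 0 <= C.
Implicit Types u v : A -> R.

(** An arbitrary continuous extension of [u], and 0 if there is none; Tietze provides one for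
    continuous [u] on the closed set [A]. *)
Definition extended u : cfun R k K :=
  xget 0 [set f : cfun R k K | forall s, f (set_val s) = mk_scalar (u s) 0].

Definition restricted_op u : I -> F^o := fun i => t i (extended u).

(** Two extensions of [u] differ by a function vanishing on [A], which [t i] kills. The choice made
    in [extended] is therefore immaterial, and linearity and bounds can be read off from convenient
    extensions. *)
Lemma restricted_opE u (f : cfun R k K) i :
  (forall s : A, f (set_val s) = mk_scalar (u s) 0) -> restricted_op u i = t i f.
Proof.
move=> fu; have ext s : extended u (set_val s) = mk_scalar (u s) 0.
  by have : extended u \in _ := mem_set (xgetPex 0 (ex_intro _ f fu)); move=> /set_mem; apply.
apply/eqP; rewrite -subr_eq0 addrC -mulN1r -tL tA// => x Ax.
pose s : A := exist _ x (mem_set Ax).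
by rewrite -[LHS]/(- 1 *: f (set_val s) + extended u (set_val s)) ext fu scaleN1r addNr.
Qed.

Lemma restricted_op_ext u : compact [set: A] -> continuous u ->
  exists2 f : cfun R k K, forall s : A, f (set_val s) = mk_scalar (u s) 0 &
    forall i, restricted_op u i = t i f.
Proof.
move=> cA cu; have [M uM] := continuous_compact_bounded cA cu.
have [|s|f [fu _]] := @cfun_extension R k K cK hK A u `|M| clA cu => //.
  by rewrite (le_trans (uM s))// ler_norm.
by exists f => // i; exact: restricted_opE.
Qed.

Lemma restricted_op_le u (M : R) i : continuous u -> 0 <= M ->
  (forall s, `|u s| <= M) -> rabs (restricted_op u i) <= C * M.
Proof.
move=> cu M0 uM; have [f [fu fM]] := @cfun_extension R k K cK hK A u M clA cu M0 uM.
rewrite (restricted_opE _ fu) (le_trans (tC _ _))// ler_wpM2l//.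
exact: sup_norm_le.
Qed.

Lemma restricted_opD u v : compact [set: A] -> continuous u -> continuous v ->
  restricted_op (fun s => u s + v s) = restricted_op u + restricted_op v.
Proof.
move=> cA cu cv; apply/funext => i; rewrite fctE.
have [f fu ->] := restricted_op_ext cA cu; have [g gv ->] := restricted_op_ext cA cv.
rewrite -[t i f]mul1r -tL; apply: restricted_opE => s.
by rewrite mk_scalarD -fu -gv -[f (set_val s)]scale1r.
Qed.

Lemma restricted_opB u v : compact [set: A] -> continuous u -> continuous v ->
  restricted_op u - restricted_op v = restricted_op (fun s => u s - v s).
Proof.
move=> cA cu cv; apply/eqP; rewrite subr_eq -restricted_opD//; last exact: continuous_fsub.
by apply/eqP; congr restricted_op; apply/funext => s; rewrite subrK.
Qed.

End extension_operator.

(** * Operators factoring through Eberlein compacta *)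

Lemma nbhs_ptws_finite (R : realType) (S : topologicalType) (u : {ptws S -> R})
    (l : seq S) (d : R) : 0 < d ->
  nbhs u [set v : {ptws S -> R} | forall s, s \in l -> `|v s - u s| < d].
Proof.
move=> d0; elim: l => [|s l IH].
  by apply: (@filterS _ _ (nbhs_filter u) setT) => //; exact: filterT.
have := @filterI _ _ (nbhs_filter u) _ _ IH (@nbhs_ptws_lt R S u s d d0).
apply: (@filterS _ _ (nbhs_filter u)) => v [/= vl vs] r.
by rewrite inE => /orP[/eqP->//|]; exact: vl.
Qed.

Section generated_by_eberlein.
Context {R : realType} {k : scalar_kind} {K : ptopologicalType} {I : choiceType}.
Hypotheses (cK : compact [set: K]) (hK : hausdorff_space K).
Local Notation F := (scalar_field R k).
Variables (S : nat -> set K) (t : nat -> I -> cfun R k K -> F) (C : nat -> R).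
Hypothesis eS : forall n, eberlein_compactum R k (set_type (S n)).
Hypothesis tL : forall n i (a : F) (f g : cfun R k K),
  t n i (a *: f + g) = a * t n i f + t n i g.
Hypothesis tS : forall n i (f : cfun R k K), (forall x, S n x -> f x = 0) -> t n i f = 0.
Hypothesis tC : forall n i (f : cfun R k K), rabs (t n i f) <= C n * sup_norm f.
Hypothesis C0 : forall n, 0 <= C n.

Let cS n : compact [set: set_type (S n)] := eberlein_compact (eS n).

Let clS n : closed (S n).
Proof.
apply: (compact_closed hK).
have cval : continuous (set_val : set_type (S n) -> K).
  exact: (@initial_continuous (S n) K set_val).
have := compact_image cval (@cS n); congr compact.
apply/seteqP; split=> [_ [s _ <-]|x Sx]; first exact: set_valP.
by exists (exist _ x (mem_set Sx)).
Qed.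

Let generators n := cid (eberlein_generated (hausdorff_set_type hK) (eS n)).
Let A (n : nat) : nat -> set (S n -> R) := projT1 (@generators n).
Arguments A : clear implicits.
Let theta n (u : S n -> R) : I -> F^o := restricted_op (t n) u.
Arguments theta : clear implicits.

Let G : set (I -> F^o) := [set g | exists n i, exists2 u, A n i u & g = theta n u].
Let Y := uspan G.

Let A_continuous n i u : A n i u -> continuous u.
Proof. by move: u; have [_ + _ _] := projT2 (@generators n); exact. Qed.

Let theta_le n (u : S n -> R) (M : R) i : continuous u -> 0 <= M ->
  (forall s, `|u s| <= M) -> rabs (theta n u i) <= C n * M.
Proof. exact: (restricted_op_le cK hK (@clS n) (@tL n) (@tS n) (@tC n) (@C0 n)). Qed.

(** A uniform approximation of [u] within some [A n i] is carried by the bounded map [theta n] to a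
    uniform approximation by members of [G]. *)
Let theta_in n (u : S n -> R) : continuous u -> theta n u \in in_uspan G.
Proof.
move=> cu; apply/asboolP; split.
  have [M uM] := continuous_compact_bounded (@cS n) cu.
  exists (C n * `|M|) => i; apply: theta_le => // s.
  by rewrite (le_trans (uM s))// ler_norm.
move=> e e0; have C1 : 0 < C n + 1 by rewrite ltr_wpDl.
have d0 : 0 < e / (C n + 1) by rewrite divr_gt0.
have [_ _ _ /(_ u _ cu d0)[i [h Ah hu]]] := projT2 (@generators n).
have ch := A_continuous Ah.
exists (theta n h); first by apply: linear_span_gen; exists n, i, h.
move=> j; rewrite -[X in rabs X]/((theta n u - theta n h) j).
rewrite /theta (restricted_opB cK hK (@clS n) (@tL n) (@tS n) (@cS n) cu ch).
rewrite (le_trans (theta_le (M := e / (C n + 1)) _ _ _ _))//.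
- exact: continuous_fsub.
- exact: ltW.
- by move=> s; rewrite distrC ltW.
- by rewrite mulrCA -[leRHS]mulr1 ler_pM2l// ler_pdivrMr// mul1r lerDl.
Qed.

(** For continuous [u] the default 0 does not occur, by [theta_in]. *)
Let th n (u : S n -> R) : Y := insubd 0 (theta n u).

Let val_th n (u : S n -> R) : continuous u -> uspan_val (th u) = theta n u.
Proof. by move=> cu; rewrite /th -[LHS]/(val _) insubdK//; exact: theta_in. Qed.

Let rnorm_th n (u : S n -> R) (M : R) : continuous u -> 0 <= M ->
  (forall s, `|u s| <= M) -> rnorm (th u) <= C n * M.
Proof.
move=> cu M0 uM; rewrite uspan_rnorm; apply: unorm_le => [|i]; first by rewrite mulr_ge0.
by rewrite val_th//; exact: theta_le.
Qed.

Let thD n (u v : S n -> R) : continuous u -> continuous v ->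
  th (fun s => u s + v s) = th u + th v.
Proof.
move=> cu cv; apply: val_inj; rewrite /= -[LHS]/(uspan_val _) val_th; last exact: continuous_fadd.
rewrite -[RHS]/(uspan_val (th u) + uspan_val (th v)) !val_th//.
exact: (restricted_opD cK hK (@clS n) (@tL n) (@tS n) (@cS n) cu cv).
Qed.

(** On [A n i] the map [th] is continuous from the pointwise to the weak topology:
    [grothendieck_finite] applies to the real and imaginary parts of each functional on [Y] composed
    with [th]. *)
Let compact_th n i : compact ((@th n) @` A n i : set (weak Y)).
Proof.
have [/(_ i) cA _ /(_ i)[M M0 AM] _] := projT2 (@generators n).
apply: (@continuous_compact {ptws S n -> R} (weak Y)) (cA).
apply/subspace_continuousP => u0 Au0; apply: cvg_weak => phi e e0.
have [N N0 phiN] := dual_le phi.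
have part (h : F -> R) : (forall x y, h (x + y) = h x + h y) ->
    (forall x, `|h x| <= rabs x) -> within (A n i) (nbhs (u0 : {ptws S n -> R}))
      [set u | `|h (phi (th u)) - h (phi (th u0))| < e / 2].
  move=> hD hle.
  have [|f M' cf M'0 fM'|l [d [d0 ld]]] := @grothendieck_finite R (S n) (@cS n)
    (fun u => h (phi (th u))) (N * C n) _ _ (A n i) M u0 (e / 2) cA
    (@A_continuous n i) M0 AM Au0 ltac:(lra).
  - by move=> f g cf cg; rewrite thD// raddfD hD.
  - rewrite (le_trans (hle _))// (le_trans (phiN _))// -mulrA ler_wpM2l//.
    exact: rnorm_th.
  have := nbhs_ptws_finite u0 l d0.
  by apply: (@filterS _ _ (nbhs_filter (u0 : {ptws S n -> R}))) => u ul Au; exact: ld.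
have := @filterI _ _ (within_filter _ (nbhs_filter _)) _ _
  (part _ scalar_reD normr_re_le) (part _ scalar_imD normr_im_le).
apply: (@filterS _ _ (within_filter _ (nbhs_filter _))) => u [/= ure uim].
rewrite (le_lt_trans (rabs_le_reim _))// [ltRHS]splitr scalar_reB scalar_imB.
by rewrite distrC [X in _ + X]distrC ltrD.
Qed.

Lemma eberlein_generated_WCG : exists H : set (I -> F^o),
  WCG (uspan H) /\ forall n (f : cfun R k K), (fun i => t n i f) \in in_uspan H.
Proof.
exists G; split; last first.
  move=> n f.
  pose re (s : S n) := scalar_re (f (set_val s)); pose im (s : S n) := scalar_im (f (set_val s)).
  have cf : continuous (fun s : S n => f (set_val s)).
    move=> s; apply: continuous_comp; first exact: initial_continuous.
    exact: cfun_continuous.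
  have cre : continuous re.
    move=> s; apply: (@continuous_comp _ F^o R _ (@scalar_re R k)) (cf s) _.
    exact: scalar_re_continuous.
  have cim : continuous im.
    move=> s; apply: (@continuous_comp _ F^o R _ (@scalar_im R k)) (cf s) _.
    exact: scalar_im_continuous.
  (* [t n i] only depends on the restriction of [f] to [S n], whose real and imaginary parts are
     within reach of [theta n]. For real scalars [mk_scalar 0 1] is 0. *)
  have -> : (fun i => t n i f) = mk_scalar 0 1 *: theta n im + theta n re.
    apply/funext => i.
    have [g gre gE] := restricted_op_ext cK hK (@clS n) (@tL n) (@tS n) (@cS n) cre.
    have [h him hE] := restricted_op_ext cK hK (@clS n) (@tL n) (@tS n) (@cS n) cim.
    rewrite -[RHS]/(mk_scalar 0 1 * theta n im i + theta n re i) /theta gE hE -tL.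
    apply/eqP; rewrite -subr_eq0 addrC -mulN1r -tL tS// => x Sx.
    pose s : S n := exist _ x (mem_set Sx).
    rewrite -[LHS]/(- 1 * (mk_scalar 0 1 * h (set_val s) + g (set_val s)) + f (set_val s)).
    rewrite gre him /re /im mulN1r addrC; apply/eqP; rewrite subr_eq0; apply/eqP.
    move: (f (set_val s)); rewrite /mk_scalar /scalar_re /scalar_im.
    case: (k) => /= [x'|[a b]]; first by rewrite mul0r add0r.
    by apply/eqP; rewrite eq_complex/=; apply/andP; split; apply/eqP; ring.
  have [_ lin] := in_uspan_submod_closed G.
  by apply: lin; exact: theta_in.
(* The countable family indexed by pairs [(n, i)] is arranged in one sequence, with [set0] at the
   codes of no pair. *)
pose W m : set Y := if unpickle m is Some (n, i) then (@th n) @` A n i else set0.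
have WE : \bigcup_m W m = [set y : Y | G (uspan_val y)].
  apply/seteqP; split=> y.
    move=> [m _]; rewrite /W; case: unpickle => // -[n i] [u Au <-].
    by exists n, i, u => //; rewrite val_th//; exact: A_continuous Au.
  move=> [n [i [u Au yu]]]; exists (pickle (n, i)) => //; rewrite /W pickleK.
  by exists u => //; apply: val_inj; rewrite /= yu -val_th//; exact: A_continuous Au.
apply: (@WCG_bigcup R k Y W) => [m|m|].
- rewrite /W; case: unpickle => [[n i]|]; last exact: compact0.
  exact: compact_th.
- rewrite /W; case: unpickle => [[n i]|]; last by exists 0.
  have [_ _ /(_ i)[M M0 AM] _] := projT2 (@generators n).
  exists (C n * M) => _ [u Au <-]; apply: rnorm_th => //; last exact: AM.
  exact: A_continuous Au.
- rewrite WE; apply: uspan_dense => _ [n [i [u Au ->]]].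
  by have /asboolP[] := theta_in (A_continuous Au).
Qed.

End generated_by_eberlein.

(** * Norming functionals and the range of T *)

Lemma in_uspan_closed (R : realType) (k : scalar_kind) (I : choiceType)
    (G : set (I -> (scalar_field R k)^o)) (g : I -> (scalar_field R k)^o) :
  (forall e : R, 0 < e -> exists2 h, h \in in_uspan G &
    forall i, rabs (g i - h i) <= e) -> g \in in_uspan G.
Proof.
move=> gG; apply/asboolP; split.
  have [h /asboolP[[M hM] _] gh] := gG 1 ltr01.
  by exists (1 + M) => i; rewrite -(subrK (h i) (g i)) (le_trans (rabsD _ _))// lerD.
move=> e e0; have [h /asboolP[_ /(_ (e / 2) ltac:(lra))[f Gf hf]] gh] := gG (e / 2) ltac:(lra).
exists f => // i; rewrite -(subrKA (h i)) (le_trans (rabsD _ _))//.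
by rewrite [leRHS]splitr lerD.
Qed.

Section norming.
Context {R : realType} {k : scalar_kind} {X : normedModType (scalar_field R k)}.
Local Notation F := (scalar_field R k).

Lemma dual_ball_le (xs : dual X) (x : X) : `|xs| <= 1 -> rabs (xs x) <= rnorm x.
Proof.
rewrite -mk_scalar1 le_rnorm /rnorm dual_normE mk_scalarK => xs1.
have [x0|x0] := eqVneq (rnorm x) 0.
  have -> : x = 0 by apply/eqP; rewrite -normr_eq0 -rnormE x0 mk_scalar0.
  by rewrite raddf0 rabs0 rnorm_ge0.
have {}x0 : 0 < rnorm x by rewrite lt0r x0 rnorm_ge0.
pose y := (mk_scalar (rnorm x)^-1 0 : F) *: x.
have y1 : rabs (xs y) <= 1.
  apply: le_trans xs1; apply: ub_le_sup.
    have [M M0 xsM] := dual_le xs; exists M => _ [z /= z1 <-].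
    rewrite (le_trans (xsM z))// ler_piMr//.
    by rewrite -(@le_rnorm R k) mk_scalar1.
  exists y => //=.
  by rewrite -mk_scalar1 le_rnorm rnormZ rabs_mk gtr0_norm ?invr_gt0// mulVf ?gt_eqF.
have xsy : xs y = mk_scalar (rnorm x)^-1 0 * xs x by rewrite /y linearZ.
move: y1; rewrite xsy rabsM rabs_mk gtr0_norm ?invr_gt0//.
by rewrite ler_pdivrMl// mulr1.
Qed.

Lemma norming_functional (x : X) : exists2 xs : dual X, `|xs| <= 1 &
  rabs (xs x) = rnorm x.
Proof.
have [x0|x0] := eqVneq x 0.
  exists 0; first by rewrite normr0.
  by rewrite x0 rnorm0 raddf0 rabs0.
(* On the line through [x], the functional that sends [a *: x] to [a * rnorm x]; the coefficient
   picked by [xget] is unique as [x] is nonzero. *)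
pose f (y : X) : F := xget 0 [set a : F | y = a *: x] * mk_scalar (rnorm x) 0.
have fE a : f (a *: x) = a * mk_scalar (rnorm x) 0.
  rewrite /f; congr (_ * _); case: xgetP => [b _ /= /esym/eqP|/(_ a)/(_ erefl)//].
  by rewrite -subr_eq0 -scalerBl scaler_eq0 (negPf x0) orbF subr_eq0 => /eqP.
have [|||||| g [gL gf gle]] := @hahn_banach R k X (@rnorm R k X) [set a *: x | a in [set: F]] f.
- exact: rnormD.
- by move=> a y; exact: rnormZ.
- by exists 0; rewrite ?scale0r.
- move=> a _ _ [b _ <-] [c _ <-]; exists (a * b + c) => //.
  by rewrite scalerDl scalerA.
- by move=> a _ _ [b _ <-] [c _ <-]; rewrite scalerA -scalerDl !fE mulrDl mulrA.
- move=> _ [a _ <-]; rewrite fE rnormZ rabsM rabs_mk ger0_norm// rnorm_ge0//.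
have [|xs xsE] := @dual_of_bound R k X g 1 gL; first by move=> y; rewrite mul1r.
exists xs; last first.
  rewrite xsE gf; last by exists 1 => //; rewrite scale1r.
  by rewrite -[x in f x]scale1r fE mul1r rabs_mk ger0_norm// rnorm_ge0.
rewrite -mk_scalar1 le_rnorm /rnorm dual_normE mk_scalarK.
apply: ge_sup; first by exists (rabs (xs 0)), 0 => //=; rewrite normr0 ler01.
move=> _ [y /= y1 <-]; rewrite xsE (le_trans (gle y))//.
by rewrite -(@le_rnorm R k) mk_scalar1.
Qed.

End norming.

Unset Implicit Arguments.

Theorem theorem4p1 (R : realType) (k : scalar_kind) (K : ptopologicalType)
    (X : completeNormedModType (scalar_field R k)) (T : {linear cfun R k K -> X})
    (mu : set (borel K) -> bidual X) :
  compact [set: K] -> hausdorff_space K ->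
  bounded_operator T ->
  representing_measure T mu ->
  (forall eps : R, 0 < eps ->
    exists KE L : set K,
      [/\ KE `|` L = [set: K],
          eberlein_compactum R k (set_type KE),
          measurable (L : set (borel K)) &
          (semivariation mu L < eps%:E)%E]) ->
  lies_in_WCG (range T).
Proof.
move=> cK hK [M0 TM0] muT dec.
pose M : R := `|M0|.
have TM f : rnorm (T f) <= M * sup_norm f.
  by rewrite (le_trans (TM0 f))// ler_wpM2r ?ler_norm//; exact: sup_norm_ge0.
have Mge0 : 0 <= M by rewrite normr_ge0.
have eps8 n : 0 <= 8 * (n.+1%:R^-1 : R) by rewrite mulr_ge0// invr_ge0.
pose eps n : R := n.+1%:R^-1.
have eps0 n : 0 < eps n by rewrite invr_gt0.
have /choice[KE /choice[L KL]] n := dec (eps n) (eps0 n).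
pose F := scalar_field R k.
(* Evaluation of functionals at [x], cut off to 0 outside the unit ball: a bounded function whose
   supremum is [rnorm x], by [norming_functional]. *)
pose J (x : X) : dual X -> F^o := fun xs => if `|xs| <= 1 then xs x else 0.
(* For [xs] in the ball, [tau] is the part of [xs o T] that depends only on the restriction to
   [KE n]; off the ball [J] is 0 and [tau = 0] serves. *)
have functional (u : nat * dual X) : exists tau : cfun R k K -> F,
    [/\ forall (a : F) (f g : cfun R k K), tau (a *: f + g) = a * tau f + tau g,
        forall f : cfun R k K, (forall x, KE u.1 x -> f x = 0) -> tau f = 0,
        forall f, rabs (tau f) <= (M + 8 * eps u.1) * sup_norm f &
        forall f, rabs (J (T f) u.2 - tau f) <= 8 * eps u.1 * sup_norm f].
  move: u => [n xs]; rewrite /J /=; have [xs1|_] := boolP (`|xs| <= 1); last first.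
    exists (fun=> 0); split=> // [a f g|f|f]; first by rewrite mulr0 addr0.
      rewrite rabs0; apply: mulr_ge0; last exact: sup_norm_ge0.
      by apply: addr_ge0 => //; exact: eps8.
    by rewrite subrr rabs0; apply: mulr_ge0; [exact: eps8|exact: sup_norm_ge0].
  have [KEL _ mL sL] := KL n.
  have [|||tau [tauL tau0 tau_le]] := @functional_almost_supported R k K cK
    (fun f => xs (T f)) (KE n) (8 * eps n).
  - by move=> a f g; rewrite !linearP.
  - exact: eps8.
  - move=> f f0; rewrite -mulrA [eps n * _]mulrC.
    apply: (semivariation_bound muT KEL mL sL xs1) => //.
      exact: sup_norm_ge0.
    by move=> x; exact: rabs_le_sup_norm.
  exists tau; split=> // f; rewrite mulrDl -(subKr (xs (T f)) (tau f)).
  rewrite (le_trans (rabsD _ _))// lerD//; last by rewrite rabsN.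
  by rewrite (le_trans (dual_ball_le _ xs1)).
have /choice[t tP] := functional.
have [|||||H [WCGH tH]] := @eberlein_generated_WCG R k K (dual X) cK hK KE
  (fun n xs => t (n, xs)) (fun n => M + 8 * eps n).
- by move=> n; case: (KL n).
- by move=> n xs; case: (tP (n, xs)).
- by move=> n xs; case: (tP (n, xs)).
- by move=> n xs; case: (tP (n, xs)).
- by move=> n; apply: addr_ge0 => //; exact: eps8.
(* The functions of [xs] given by [t (n, xs) f] approach [J (T f)] uniformly, with error at most
   [8 / (n + 1) * sup_norm f]. *)
have JT f : J (T f) \in in_uspan H.
  apply: in_uspan_closed => e e0.
  have f1 : 0 < 8 * (sup_norm f + 1) by rewrite mulr_gt0// ltr_wpDl// (sup_norm_ge0 cK).
  have [n nP] := natSinv_small (divr_gt0 e0 f1).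
  exists (fun xs => t (n, xs) f) => [|xs]; first exact: tH.
  have [_ _ _ /(_ f)/le_trans] := tP (n, xs); apply.
  have := nP n (leqnn n); rewrite ltr_pdivlMr// => /ltW; apply: le_trans.
  rewrite [leRHS]mulrCA [leRHS]mulrA; apply: ler_wpM2l; first exact: eps8.
  by rewrite lerDl.
(* Only the values on the range of [T] matter, where [JT] excludes the default 0. *)
pose j (x : X) : uspan H := insubd 0 (J x).
have jE f : uspan_val (j (T f)) = J (T f) by rewrite /j -[LHS]/(val _) insubdK.
exists (uspan H), j; split=> //.
- move=> a _ _ [f _ <-] [g _ <-]; rewrite -linearP; apply: val_inj.
  apply/funext => xs; rewrite -[LHS]/(uspan_val _ _) jE.
  rewrite -[RHS]/(a * uspan_val (j (T f)) xs + uspan_val (j (T g)) xs) !jE /J.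
  by case: ifP => _; rewrite ?linearP// mulr0 addr0.
- move=> _ [f _ <-]; rewrite -!rnormE uspan_rnorm; congr mk_scalar.
  apply/eqP; rewrite eq_le; apply/andP; split.
    apply: unorm_le => [|xs]; first exact: rnorm_ge0.
    rewrite jE /J; case: ifPn => [xs1|_]; first exact: dual_ball_le.
    by rewrite rabs0 rnorm_ge0.
  have [xs xs1 <-] := norming_functional (T f).
  by have := le_unorm (j (T f)) xs; rewrite jE /J xs1.
Qed.
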